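(* For every rational $\alpha \in (0,1)$, there is an algorithm running in time $m \cdot \mathrm{poly}(1/\alpha)$ that, given any 2-CNF formula $F$ on $n$ variables with $m$ clauses, decides whether $\#\mathrm{SAT}(F) \geq \alpha \cdot 2^n$. Furthermore, whenever $\#\mathrm{SAT}(F) \geq \alpha\cdot 2^n$, the algorithm outputs the exact value $\#\mathrm{SAT}(F)$ together with a decision tree representation of $F$ of size $\mathrm{poly}(1/\alpha)$, whose internal nodes are labeled by variables and whose leaves are labeled by 1-CNFs.
   Context: A $k$-CNF is a conjunction of clauses (disjunctions of literals), each with at most $k$ literals; a 1-CNF is a conjunction of literals. $\#\mathrm{SAT}(F)$ is the number of satisfying assignments of $F$ over its $n$ variables. A decision tree represents $F$ if for every assignment, following the path determined by the values of the internal-node variables leads to a leaf whose 1-CNF evaluates to the same value as $F$ on that assignment. *)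

(* Defs.v *)
From mathcomp Require Import all_boot all_order all_algebra.
Set Implicit Arguments.
Unset Strict Implicit.
Unset Printing Implicit Defensive.

(* CNF formulas over the n variables 'I_n.  The literal (x, b) is satisfied
   when x has value b, so b = false is a negated variable.  Clauses may be
   empty, and may contain repeated or complementary literals. *)

Definition assignment (n : nat) := {ffun 'I_n -> bool}.
Definition literal (n : nat) := ('I_n * bool)%type.
Definition clause (n : nat) := seq (literal n).
Definition cnf (n : nat) := seq (clause n).

Definition literal_val n (a : assignment n) (l : literal n) : bool :=
  a l.1 == l.2.

Definition clause_val n (a : assignment n) (c : clause n) : bool :=
  has (literal_val a) c.

Definition cnf_val n (a : assignment n) (F : cnf n) : bool :=
  all (clause_val a) F.

Definition is_kcnf (k n : nat) (F : cnf n) : bool :=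
  all (fun c => size c <= k) F.

Definition nsat n (F : cnf n) : nat := #|[set a : assignment n | cnf_val a F]|.

(* In DNode x t0 t1, t0 is followed when x is false and t1 when x is true.
   A leaf carries a 1-CNF, given as the list of the literals it conjoins. *)
Inductive dtree (n : nat) : Type :=
| DLeaf of seq (literal n)
| DNode of 'I_n & dtree n & dtree n.

Fixpoint dtree_val n (a : assignment n) (t : dtree n) : bool :=
  match t with
  | DLeaf ls => all (literal_val a) ls
  | DNode x t0 t1 => if a x then dtree_val a t1 else dtree_val a t0
  end.

Definition represents n (t : dtree n) (F : cnf n) : Prop :=
  forall a : assignment n, dtree_val a t = cnf_val a F.

(* Number of nodes.  A leaf counts for 1 whatever the length of its 1-CNF:
   the total number of literals cannot be bounded independently of n, as
   (x | y_1) & ... & (x | y_n) shows. *)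
Fixpoint dtree_size n (t : dtree n) : nat :=
  match t with
  | DLeaf _ => 1
  | DNode _ t0 t1 => (dtree_size t0 + dtree_size t1).+1
  end.

(* Algorithms are programs for a word RAM with w-bit words, written in
   structured form.  The memory consists of arrays of words; a program names
   its arrays by fixed numbers, hence uses only finitely many of them, while
   the index into an array is computed.  Every operation has unit cost. *)

Definition memory := nat -> nat -> nat.

Definition update (mu : memory) (a i v : nat) : memory :=
  fun b j => if (b == a) && (j == i) then v else mu b j.

Inductive expr : Type :=
| EConst of nat
| EGet of nat & expr
| EAdd of expr & expr
| ESub of expr & expr
| ELt of expr & expr
| EEq of expr & expr.

Inductive cmd : Type :=
| CSkip
| CSet of nat & expr & expr
| CSeq of cmd & cmd
| CIf of expr & cmd & cmd
| CWhile of expr & cmd.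

(* Addition wraps around modulo 2 ^ w; subtraction is truncated at 0. *)
Fixpoint eval (w : nat) (mu : memory) (e : expr) : nat :=
  match e with
  | EConst c => c %% 2 ^ w
  | EGet a e1 => mu a (eval w mu e1)
  | EAdd e1 e2 => (eval w mu e1 + eval w mu e2) %% 2 ^ w
  | ESub e1 e2 => eval w mu e1 - eval w mu e2
  | ELt e1 e2 => (eval w mu e1 < eval w mu e2) %% 2 ^ w
  | EEq e1 e2 => (eval w mu e1 == eval w mu e2) %% 2 ^ w
  end.

Fixpoint expr_cost (e : expr) : nat :=
  match e with
  | EConst _ => 1
  | EGet _ e1 => (expr_cost e1).+1
  | EAdd e1 e2 | ESub e1 e2 | ELt e1 e2 | EEq e1 e2 =>
      (expr_cost e1 + expr_cost e2).+1
  end.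

(* exec w c mu t mu': with w-bit words, c started in memory mu terminates
   after t steps in memory mu'. *)
Inductive exec (w : nat) : cmd -> memory -> nat -> memory -> Prop :=
| ExecSkip mu : exec w CSkip mu 1 mu
| ExecSet mu a e1 e2 :
    exec w (CSet a e1 e2) mu (expr_cost e1 + expr_cost e2).+1
      (update mu a (eval w mu e1) (eval w mu e2))
| ExecSeq c1 c2 mu t1 mu1 t2 mu2 :
    exec w c1 mu t1 mu1 -> exec w c2 mu1 t2 mu2 ->
    exec w (CSeq c1 c2) mu (t1 + t2) mu2
| ExecIfTrue e c1 c2 mu t mu' :
    eval w mu e != 0 -> exec w c1 mu t mu' ->
    exec w (CIf e c1 c2) mu (expr_cost e + t).+1 mu'
| ExecIfFalse e c1 c2 mu t mu' :
    eval w mu e = 0 -> exec w c2 mu t mu' ->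
    exec w (CIf e c1 c2) mu (expr_cost e + t).+1 mu'
| ExecWhileFalse e c mu :
    eval w mu e = 0 -> exec w (CWhile e c) mu (expr_cost e).+1 mu
| ExecWhileTrue e c mu t1 mu1 t2 mu2 :
    eval w mu e != 0 -> exec w c mu t1 mu1 ->
    exec w (CWhile e c) mu1 t2 mu2 ->
    exec w (CWhile e c) mu (expr_cost e + t1 + t2).+1 mu2.

Lemma exec_det w c mu t1 mu1 t2 mu2 :
  exec w c mu t1 mu1 -> exec w c mu t2 mu2 -> t1 = t2 /\ mu1 = mu2.
Proof.
move=> E1; elim: E1 t2 mu2 => {c mu t1 mu1}; intros;
  match goal with E : exec _ _ _ ?t ?m |- _ = ?t /\ _ = ?m =>
    inversion E; subst; clear E end;
  repeat match goal with
  | nz : is_true (?v != 0), z : ?v = 0 |- _ => by rewrite z in nz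
  | IH : forall t m, exec ?w ?c ?mu t m -> _, E : exec ?w ?c ?mu _ _ |- _ =>
      case: (IH _ _ E) => ? ?; subst; clear E
  end; by [].
Qed.

Definition encode_literal n (l : literal n) : seq nat :=
  [:: l.1 : nat; l.2 : nat].

Definition encode_literals n (ls : seq (literal n)) : seq nat :=
  size ls :: flatten [seq encode_literal l | l <- ls].

Definition encode_cnf n (F : cnf n) : seq nat :=
  [:: n, size F & flatten [seq encode_literals c | c <- F]].

Fixpoint encode_dtree n (t : dtree n) : seq nat :=
  match t with
  | DLeaf ls => 0 :: encode_literals ls
  | DNode x t0 t1 => [:: 1, x : nat & encode_dtree t0 ++ encode_dtree t1]
  end.

(* Array 0 holds the input formula; all other cells are initially 0. *)
Definition input_memory n (F : cnf n) : memory :=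
  fun a i => if a == 0 then nth 0 (encode_cnf F) i else 0.

Definition answer_array : nat := 1.
Definition count_array : nat := 2.
Definition tree_array : nat := 3.

Definition outputs_answer (mu : memory) (b : bool) : Prop :=
  mu answer_array 0 = b.

(* Binary, one bit per cell, least significant bit first.  A number at most
   2 ^ n occupies n + 1 cells. *)
Definition outputs_count (n : nat) (mu : memory) (v : nat) : Prop :=
  (forall i, i <= n -> mu count_array i <= 1) /\
  \sum_(i < n.+1) mu count_array i * 2 ^ i = v.

Definition outputs_dtree n (mu : memory) (t : dtree n) : Prop :=
  forall i, i < size (encode_dtree t) ->
    mu tree_array i = nth 0 (encode_dtree t) i.

(* Main.v *)
Require Import Defs.
From mathcomp Require Import all_boot all_order all_algebra.
From mathcomp Require Import zify.
Set Implicit Arguments.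
Unset Strict Implicit.
Unset Printing Implicit Defensive.

(* Choose greedily clauses with pairwise disjoint variables.  If there are [L]
   of them, at most a fraction (3/4)^L < alpha of the assignments satisfies the
   formula.  Otherwise every clause with two distinct variables meets the fewer
   than [2 L] chosen variables, so once these are assigned the formula is a
   1-CNF: branching on all of them gives a tree with at most 4^L <= 4 alpha^-5
   leaves, and unit propagation at a leaf that leaves [n - q] variables free
   contributes 2^(n - q) to the count, or nothing after a conflict.  Since
   [q] is at most three times the number of clauses, both the additions to the
   binary counter and the final comparison with the threshold touch only the
   top bits of the count, so that the running time does not depend on [n]. *)

(** * Runs with a cost bound *)

(** The machine has no recursion, and no step may cost time growing with [n]; both facts shape the
    construction. As the program may depend on alpha, the branching is unrolled into the program
    text, whose size is exponential in [L] but fixed once alpha is. The tables indexed by variables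
    rely on cells being initially 0 and are only ever accessed at variables occurring in clauses, by
    running through the clauses. A single pass of unit propagation is enough. Under an assignment of
    the matched variables every clause has at most one undetermined variable, so a clause is
    satisfied, forces a literal, or conflicts with what is already fixed; a forced literal never
    creates work for a clause that was scanned before. The constant 3 is 2 + 1: each clause
    contributes at most two matched variables and at most one propagated variable. *)

Definition runs (w : nat) (c : cmd) (mu : memory) (T : nat)
    (Q : memory -> Prop) : Prop :=
  exists t mu', [/\ exec w c mu t mu', t <= T & Q mu'].

Fixpoint loop_free (c : cmd) : bool :=
  match c with
  | CSkip | CSet _ _ _ => true
  | CSeq c1 c2 | CIf _ c1 c2 => loop_free c1 && loop_free c2
  | CWhile _ _ => false
  end.

(* For [CWhile] the values of [sem] and [cost_bound] are junk. *)
Fixpoint sem (w : nat) (c : cmd) (mu : memory) : memory :=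
  match c with
  | CSkip | CWhile _ _ => mu
  | CSet a e1 e2 => update mu a (eval w mu e1) (eval w mu e2)
  | CSeq c1 c2 => sem w c2 (sem w c1 mu)
  | CIf e c1 c2 => if eval w mu e == 0 then sem w c2 mu else sem w c1 mu
  end.

Fixpoint cost_bound (c : cmd) : nat :=
  match c with
  | CSkip | CWhile _ _ => 1
  | CSet _ e1 e2 => (expr_cost e1 + expr_cost e2).+1
  | CSeq c1 c2 => cost_bound c1 + cost_bound c2
  | CIf e c1 c2 => (expr_cost e + maxn (cost_bound c1) (cost_bound c2)).+1
  end.

Fixpoint writes (c : cmd) : seq nat :=
  match c with
  | CSkip => [::]
  | CSet a _ _ => [:: a]
  | CSeq c1 c2 | CIf _ c1 c2 => writes c1 ++ writes c2
  | CWhile _ c => writes c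
  end.

Lemma runs_weaken w c mu T T' (Q Q' : memory -> Prop) :
  runs w c mu T Q -> T <= T' -> (forall mu', Q mu' -> Q' mu') ->
  runs w c mu T' Q'.
Proof.
move=> [t [mu' [E le_t q]]] leT QQ'; exists t, mu'.
by split=> //; [apply: leq_trans leT | apply: QQ'].
Qed.

Lemma runs_sem w c mu T (Q : memory -> Prop) :
  loop_free c -> cost_bound c <= T -> Q (sem w c mu) -> runs w c mu T Q.
Proof.
move=> lf leT q.
have [t E le_t] : exists2 t, exec w c mu t (sem w c mu) & t <= cost_bound c.
  elim: c mu lf {leT q} => //=.
  - by move=> mu _; exists 1 => //; constructor.
  - by move=> a e1 e2 mu _; exists (expr_cost e1 + expr_cost e2).+1 => //; constructor.
  - move=> c1 IH1 c2 IH2 mu /andP[/(IH1 mu) [t1 E1 le1]].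
    move=> /(IH2 (sem w c1 mu)) [t2 E2 le2].
    by exists (t1 + t2); [apply: ExecSeq E1 E2 | apply: leq_add].
  - move=> e c1 IH1 c2 IH2 mu /andP[/(IH1 mu) [t1 E1 le1]].
    move=> /(IH2 mu) [t2 E2 le2].
    case: eqP => [e0 | /eqP e0].
      by exists (expr_cost e + t2).+1; [apply: ExecIfFalse | lia].
    by exists (expr_cost e + t1).+1; [apply: ExecIfTrue | lia].
by exists t, (sem w c mu); split=> //; apply: leq_trans leT.
Qed.

Lemma runs_seq w c1 c2 mu T1 T2 T (Q : memory -> Prop) :
  runs w c1 mu T1 (fun mu1 => runs w c2 mu1 T2 Q) -> T1 + T2 <= T ->
  runs w (CSeq c1 c2) mu T Q.
Proof.
move=> [t1 [mu1 [E1 le1 [t2 [mu2 [E2 le2 q]]]]]] leT.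
exists (t1 + t2), mu2; split=> //; first exact: ExecSeq E1 E2.
by apply: leq_trans leT; apply: leq_add.
Qed.

Lemma runs_if w e c1 c2 mu T (Q : memory -> Prop) :
  (eval w mu e != 0 -> runs w c1 mu T Q) ->
  (eval w mu e = 0 -> runs w c2 mu T Q) ->
  runs w (CIf e c1 c2) mu ((expr_cost e).+1 + T) Q.
Proof.
move=> r1 r2; case: (eqVneq (eval w mu e) 0) => [e0 | e0].
  have [t [mu' [E le_t q]]] := r2 e0.
  by exists (expr_cost e + t).+1, mu'; split=> //; [apply: ExecIfFalse | lia].
have [t [mu' [E le_t q]]] := r1 e0.
by exists (expr_cost e + t).+1, mu'; split=> //; [apply: ExecIfTrue | lia].
Qed.

(** The invariant is indexed by the number of completed iterations, and every state either exits
    with [Q] or takes one more step; the loop may stop before its bound [N], as carry propagation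
    does. *)
Lemma runs_while w N B (I : nat -> memory -> Prop) e c mu T (Q : memory -> Prop) :
  I 0 mu ->
  (forall k mu1, I k mu1 ->
     eval w mu1 e = 0 /\ Q mu1 \/
     [/\ eval w mu1 e != 0, k < N & runs w c mu1 B (I k.+1)]) ->
  N * ((expr_cost e).+1 + B) + (expr_cost e).+1 <= T ->
  runs w (CWhile e c) mu T Q.
Proof.
move=> I0 step leT.
suff /(_ N 0 mu I0 (subn0 N)) [t [mu' [E le_t q]]] :
    forall r k mu1, I k mu1 -> N - k = r ->
    runs w (CWhile e c) mu1 (r * ((expr_cost e).+1 + B) + (expr_cost e).+1) Q.
  by exists t, mu'; split=> //; apply: leq_trans leT.
elim=> [|r IH] k mu1 Ik.
  move=> r0; case: (step _ _ Ik) => [[e0 q] | [_ ltk _]]; last by lia.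
  by exists (expr_cost e).+1, mu1; split=> //; apply: ExecWhileFalse.
move=> kr; case: (step _ _ Ik) => [[e0 q] | [e1 ltk [t [mu2 [E le_t Ik1]]]]].
  by exists (expr_cost e).+1, mu1; split=> //; [apply: ExecWhileFalse | lia].
have [|t' [mu' [E' le_t' q]]] := IH k.+1 mu2 Ik1; first lia.
exists (expr_cost e + t + t').+1, mu'; split=> //; last lia.
exact: ExecWhileTrue E E'.
Qed.

Lemma exec_writes w c mu t mu' :
  exec w c mu t mu' -> forall a i, a \notin writes c -> mu' a i = mu a i.
Proof.
elim=> {c mu t mu'} //=.
- by move=> mu a e1 e2 b i; rewrite inE /update => /negPf->.
- by move=> c1 c2 mu t1 mu1 t2 mu2 _ IH1 _ IH2 a i;
    rewrite mem_cat negb_or => /andP[n1 n2]; rewrite IH2 // IH1.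
- by move=> e c1 c2 mu t mu' _ _ IH a i;
    rewrite mem_cat negb_or => /andP[n1 n2]; rewrite IH.
- by move=> e c1 c2 mu t mu' _ _ IH a i;
    rewrite mem_cat negb_or => /andP[n1 n2]; rewrite IH.
- by move=> e c mu t1 mu1 t2 mu2 _ _ IH1 _ IH2 a i nc; rewrite IH2 // IH1.
Qed.

(** Footprints are kept per array, not per cell: arrays are named by constants, so disjointness
    conditions are decided by computation. *)
Definition frame (S : seq nat) (mu mu' : memory) : Prop :=
  forall a i, a \notin S -> mu' a i = mu a i.

Lemma frame_sub (S S' : seq nat) mu mu' :
  all (mem S') S -> frame S mu mu' -> frame S' mu mu'.
Proof. by move=> /allP sub f a i aS'; apply: f; apply: contra aS' => /sub. Qed.

Lemma runs_frame S w c mu T (Q : memory -> Prop) :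
  all (mem S) (writes c) -> runs w c mu T Q ->
  runs w c mu T (fun mu' => frame S mu mu' /\ Q mu').
Proof.
move=> sub [t [mu' [E le_t q]]]; exists t, mu'; split=> //; split=> //.
by apply: (frame_sub sub) => a i; apply: exec_writes E a i.
Qed.

Notation var a := (EGet a (EConst 0)) (only parsing).
Notation set_var a e := (CSet a (EConst 0) e) (only parsing).

Definition for_loop (a : nat) (bound : expr) (c : cmd) : cmd :=
  CSeq (set_var a (EConst 0))
    (CWhile (ELt (var a) bound) (CSeq c (set_var a (EAdd (var a) (EConst 1))))).

Lemma runs_for w N B (I : nat -> memory -> Prop) a bound c mu T
    (Q : memory -> Prop) :
  1 < 2 ^ w -> N < 2 ^ w ->
  I 0 (update mu a 0 0) ->
  (forall k mu1, I k mu1 ->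
     [/\ mu1 a 0 = k, k <= N & eval w mu1 bound = N]) ->
  (forall k mu1, k < N -> I k mu1 ->
     runs w c mu1 B (fun mu2 => mu2 a 0 = k /\ I k.+1 (update mu2 a 0 k.+1))) ->
  (forall mu1, I N mu1 -> Q mu1) ->
  N * (expr_cost bound + B + 11) + expr_cost bound + 11 <= T ->
  runs w (for_loop a bound c) mu T Q.
Proof.
move=> W1 ltN I0 Ib step IQ leT.
apply: (@runs_seq _ _ _ _ 3 (N * (expr_cost bound + B + 11) + expr_cost bound + 4)).
  apply: runs_sem => //=; rewrite mod0n.
  apply: (@runs_while _ N (B + 6) I) => //=; last lia.
  move=> k mu1 Ik; have [ak leN Eb] := Ib _ _ Ik.
  rewrite mod0n ak Eb.
  case: (ltnP k N) => [ltk | geN] /=; last first.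
    by left; rewrite mod0n; split=> //; apply: IQ; have <-: k = N by lia.
  right; split=> //; first by rewrite modn_small.
  apply: (@runs_seq _ _ _ _ B 6) => //.
  apply: runs_weaken (step _ _ ltk Ik) _ _ => // mu2 [ak2 Ik2].
  apply: runs_sem => //=; rewrite mod0n ak2 (modn_small W1) modn_small ?addn1 //.
  lia.
lia.
Qed.

(** * Symbolic execution of straight-line blocks *)

Definition block (cs : seq cmd) : cmd := foldr CSeq CSkip cs.

(** Index and value are announced in closed form, so that each wrap-around modulo [2 ^ w] is
    discharged once and the memory stays a readable chain of updates. *)
Lemma sem_assign w a e1 e2 cs mu i v :
  eval w mu e1 = i -> eval w mu e2 = v ->
  sem w (block (CSet a e1 e2 :: cs)) mu = sem w (block cs) (update mu a i v).
Proof. by move=> <- <-. Qed.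

Lemma sem_true w e c1 c2 mu :
  eval w mu e <> 0 -> sem w (CIf e c1 c2) mu = sem w c1 mu.
Proof. by move=> /eqP/negPf /= ->. Qed.

Lemma sem_false w e c1 c2 mu :
  eval w mu e = 0 -> sem w (CIf e c1 c2) mu = sem w c2 mu.
Proof. by move=> /= ->. Qed.

Ltac arith :=
  try done;
  repeat match goal with H : ?T |- _ =>
    lazymatch T with
    | is_true (leq _ _) => fail
    | @eq nat _ _ => fail
    | _ => clear H
    end
  end; lia.

Ltac evaluate eqs :=
  rewrite /= /update /= ?(mod0n, eqxx, eqs) ?modn_small ?(eqxx, eqs) /=; try arith.

Ltac assign i v eqs :=
  rewrite (@sem_assign _ _ _ _ _ _ i v); [ | by evaluate eqs | by evaluate eqs].

Lemma sem_seq w c1 c2 mu : sem w (CSeq c1 c2) mu = sem w c2 (sem w c1 mu).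
Proof. by []. Qed.

Lemma sem_writes w c mu a i : a \notin writes c -> sem w c mu a i = mu a i.
Proof.
elim: c mu => //= [b e1 e2|c1 IH1 c2 IH2|e c1 IH1 c2 IH2] mu.
- by rewrite inE /update => /negPf->.
- by rewrite mem_cat negb_or => /andP[n1 n2]; rewrite IH2 // IH1.
- by rewrite mem_cat negb_or => /andP[n1 n2]; case: eqP; rewrite (IH1, IH2).
Qed.

(** * Counting *)

(* A partial assignment [r] stores 0 at an unassigned variable and [b.+1] at a
   variable with value [b]. *)
Definition agree n (r : nat -> nat) (a : assignment n) : bool :=
  [forall x : 'I_n, (r x == 0) || (r x == (a x).+1)].

Definition flip n (x : 'I_n) (a : assignment n) : assignment n :=
  [ffun y => (y == x) (+) a y].

Lemma flipK n (x : 'I_n) : involutive (flip x).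
Proof. by move=> a; apply/ffunP => y; rewrite !ffunE addbA addbb. Qed.

(** Flipping [x] preserves [P] and exchanges the assignments with [a x = b] and those with
    [a x <> b], which are therefore two equal halves. *)
Lemma card_flip n (x : 'I_n) b (P : pred (assignment n)) :
  (forall a, P (flip x a) = P a) ->
  2 * #|[set a | P a && (a x == b)]| = #|[set a | P a]|.
Proof.
move=> Pf; rewrite mul2n -addnn -(cardsID [set a : assignment n | a x == b] [set a | P a]).
congr (_ + _); first by apply: eq_card => a; rewrite !inE.
rewrite -(card_imset _ (inv_inj (flipK x))); apply: eq_card => a.
rewrite !inE; apply/imsetP/andP => [[a' + ->]|[ax Pa]].
  by rewrite !inE Pf ffunE eqxx => /andP[-> /eqP->]; case: b.
exists (flip x a); last by rewrite flipK.
by rewrite inE Pf Pa ffunE eqxx /=; case: (a x) ax; case: b.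
Qed.

Lemma agree0 n (a : assignment n) (r : nat -> nat) : (forall x : 'I_n, r x = 0) -> agree r a.
Proof. by move=> r0; apply/forallP => x; rewrite r0. Qed.

Lemma agree_neq n (r : nat -> nat) (a : assignment n) (l : literal n) :
  agree r a -> r l.1 <> 0 -> r l.1 <> l.2.+1 -> literal_val a l = false.
Proof.
move=> /forallP/(_ l.1)/orP[/eqP //|/eqP->] _ ne.
by apply/eqP => e; case: ne; rewrite e.
Qed.

Lemma agree_eq n (r : nat -> nat) (a : assignment n) (l : literal n) :
  agree r a -> r l.1 = l.2.+1 -> literal_val a l.
Proof.
move=> /forallP/(_ l.1)/orP[/eqP->//|/eqP->] []; rewrite /literal_val.
by case: (a l.1); case: (l.2).
Qed.

Lemma agree_set n (r r' : nat -> nat) (l : literal n) (a : assignment n) :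
  r l.1 = 0 -> (forall y : 'I_n, r' y = if y == l.1 then l.2.+1 else r y) ->
  agree r' a = agree r a && literal_val a l.
Proof.
move=> r0 r'E; apply/forallP/andP => [ag | [/forallP ag /eqP al] x].
  split; last first.
    have := ag l.1; rewrite r'E eqxx /= /literal_val.
    by case: (a l.1); case: (l.2).
  apply/forallP => x; have := ag x; rewrite r'E.
  by case: (x =P l.1) => [->|_ //]; rewrite r0.
by rewrite r'E; case: (x =P l.1) => [->|_]; [rewrite al eqxx orbT | apply: ag].
Qed.

Lemma agree_flip n (r : nat -> nat) (x : 'I_n) (a : assignment n) :
  r x = 0 -> agree r (flip x a) = agree r a.
Proof.
move=> r0; apply: eq_forallb => y; rewrite ffunE.
by case: (y =P x) => [->|//]; rewrite r0.
Qed.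

Lemma card_agree_set n (r r' : nat -> nat) (l : literal n) :
  r l.1 = 0 -> (forall y : 'I_n, r' y = if y == l.1 then l.2.+1 else r y) ->
  2 * #|[set a : assignment n | agree r' a]| = #|[set a : assignment n | agree r a]|.
Proof.
move=> r0 r'E; rewrite -(card_flip (x := l.1) l.2 (P := @agree n r)); last first.
  by move=> a; apply: agree_flip.
by congr (2 * _); apply: eq_card => a; rewrite !inE (agree_set _ r0 r'E).
Qed.

Lemma card_assignment n : #|{: assignment n}| = 2 ^ n.
Proof. by rewrite card_ffun card_bool card_ord. Qed.

(** * Satisfaction of clauses with pairwise disjoint variables *)

Definition pair_clause n := (literal n * literal n)%type.

Definition pair_val n (a : assignment n) (g : pair_clause n) : bool :=
  literal_val a g.1 || literal_val a g.2.

Definition pair_vars n (G : seq (pair_clause n)) : seq nat :=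
  [seq val g.1.1 | g <- G] ++ [seq val g.2.1 | g <- G].

Lemma pair_val_flip n (x : 'I_n) (G : seq (pair_clause n)) a :
  val x \notin pair_vars G ->
  all (pair_val (flip x a)) G = all (pair_val a) G.
Proof.
rewrite mem_cat negb_or => /andP[n1 n2]; apply: eq_in_all => g gG.
have ne1 : (g.1.1 == x) = false.
  by apply: contraNF n1 => /eqP<-; apply: (map_f (fun g : pair_clause n => val g.1.1)).
have ne2 : (g.2.1 == x) = false.
  by apply: contraNF n2 => /eqP<-; apply: (map_f (fun g : pair_clause n => val g.2.1)).
by rewrite /pair_val /literal_val !ffunE ne1 ne2.
Qed.

(** The new clause fails exactly when both its variables take the values opposite to its literals.
    As these variables are distinct and absent from [G], halving twice shows that it removes exactly
    a quarter of the models of [G]. *)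
Lemma card_disjoint_clause n (G : seq (pair_clause n)) g :
  g.1.1 != g.2.1 -> val g.1.1 \notin pair_vars G -> val g.2.1 \notin pair_vars G ->
  4 * #|[set a | all (pair_val a) (rcons G g)]| = 3 * #|[set a | all (pair_val a) G]|.
Proof.
move=> ne n1 n2.
have c1 := card_flip (x := g.1.1) (~~ g.1.2) (fun a => pair_val_flip a n1).
pose P a := all (pair_val a) G && (a g.1.1 == ~~ g.1.2).
have Pf a : P (flip g.2.1 a) = P a by rewrite /P pair_val_flip // ffunE (negPf ne).
have c2 := card_flip (~~ g.2.2) Pf.
have := cardsID [set a : assignment n | pair_val a g] [set a | all (pair_val a) G].
have -> : [set a | all (pair_val a) G] :\: [set a | pair_val a g] =
    [set a : assignment n | all (pair_val a) G && (a g.1.1 == ~~ g.1.2) && (a g.2.1 == ~~ g.2.2)].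
  apply/setP => a; rewrite !inE /pair_val /literal_val negb_or.
  by case: (a g.1.1) (a g.2.1) (g.1.2) (g.2.2) => [] [] [] []; rewrite ?andbT ?andbF.
have -> : [set a | all (pair_val a) G] :&: [set a | pair_val a g] =
    [set a | all (pair_val a) (rcons G g)].
  by apply/setP => a; rewrite !inE all_rcons andbC.
move=> c3; move: c1 c2 c3.
set N := #|[set a | all (pair_val a) G]|; set N1 := #|[set a | P a]|; set N2 := #|[set a | P a && _]|.
move=> c1 c2 c3; have {}c1 : 2 * N1 = N := c1; have {}c3 : _ + N2 = N := c3.
lia.
Qed.

(** * Binary counters *)

Definition binval (n : nat) (c : nat -> nat) : nat := \sum_(i < n.+1) c i * 2 ^ i.

Lemma binval_set n (c c' : nat -> nat) p v :
  p <= n -> (forall i, c' i = if i == p then v else c i) ->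
  binval n c' + c p * 2 ^ p = binval n c + v * 2 ^ p.
Proof.
move=> lep c'E; rewrite /binval.
have ltp : p < n.+1 by [].
rewrite (bigD1 (Ordinal ltp)) //= [in RHS](bigD1 (Ordinal ltp)) //= c'E eqxx.
rewrite (eq_bigr (fun i : 'I_n.+1 => c i * 2 ^ i)); first by lia.
by move=> i; rewrite -val_eqE /= c'E => /negPf->.
Qed.

Lemma binval_ge n (c : nat -> nat) p : p <= n -> c p * 2 ^ p <= binval n c.
Proof.
move=> lep; have ltp : p < n.+1 by [].
by rewrite /binval (bigD1 (Ordinal ltp)) //= leq_addr.
Qed.

(** The number written by the [k] most significant bits, by Horner's rule from position [n]
    downwards, which is the order in which the comparison loop reads them. *)
Fixpoint top_bits (n : nat) (c : nat -> nat) (k : nat) : nat :=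
  if k is k'.+1 then 2 * top_bits n c k' + c (n - k') else 0.

Lemma binval_top_bits n c k :
  k <= n.+1 -> (forall i, i < n.+1 - k -> c i = 0) ->
  binval n c = 2 ^ (n.+1 - k) * top_bits n c k.
Proof.
have split_top : k <= n.+1 ->
    binval n c = 2 ^ (n.+1 - k) * top_bits n c k + \sum_(i < n.+1 - k) c i * 2 ^ i.
  elim: k => [|k IH] lek; first by rewrite muln0 subn0.
  rewrite IH ?(ltnW lek) // (_ : n.+1 - k = (n - k).+1); last by lia.
  by rewrite big_ord_recr /= subSS expnS; lia.
move=> lek c0; rewrite split_top // big1 ?addn0 // => i _.
by rewrite c0.
Qed.

Lemma onth_take_rcons (T : Type) (s : seq T) k x :
  onth s k = Some x -> take k.+1 s = rcons (take k s) x.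
Proof.
elim: s k => [|y s IH] [|k] //=; first by case=> ->; rewrite take0.
by move/IH; rewrite /= => ->.
Qed.

Lemma onth_size (T : Type) (s : seq T) k : k < size s -> exists x, onth s k = Some x.
Proof. by rewrite -onthTE; case: (onth s k) => // x; exists x. Qed.

(* The exponent 5 comes from [4 * 3 ^ 5 <= 4 ^ 5]. *)
Lemma exists_threshold a b :
  0 < a < b -> exists L, b * 3 ^ L < a * 4 ^ L /\ a ^ 5 * 4 ^ L <= 4 * b ^ 5.
Proof.
move=> /andP[a0 ab].
have ex : exists L, b * 3 ^ L < a * 4 ^ L.
  (* Bernoulli's inequality (1 + 1/3)^L >= 1 + L/3 with denominators cleared. *)
  have bern L : 3 ^ L * (3 + L) <= 3 * 4 ^ L.
    by elim: L => // L IH; rewrite !expnS; nia.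
  (* There it gives [3 ^ (3 * b) * (1 + b) <= 4 ^ (3 * b)]. *)
  exists (3 * b); apply: leq_trans (leq_pmull _ a0).
  have := bern (3 * b); have : 0 < 3 ^ (3 * b) by rewrite expn_gt0.
  nia.
(* The least such exponent is nonzero because [a < b], and its predecessor violates the inequality;
   this bounds the power of 4 from above. *)
case: (ex_minnP ex) => [[|L]]; first by rewrite !expn0; lia.
move=> bL minL; exists L.+1; split=> //.
have {minL} : a * 4 ^ L <= b * 3 ^ L.
  by rewrite leqNgt; apply/negP => /minL; rewrite ltnn.
rewrite -(leq_exp2r _ _ (isT : 0 < 5)) !expnMn -!expnM => le5.
have le : 4 ^ L * 3 ^ (L * 5) <= 4 ^ (L * 5).
  rewrite !(mulnC L) !expnM -expnMn; case: L {bL le5} => // L.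
  by rewrite leq_exp2r.
rewrite [4 ^ L.+1]expnS mulnCA leq_pmul2l //.
rewrite -(leq_pmul2r (m := 3 ^ (L * 5))) ?expn_gt0 //.
by apply: leq_trans le5; rewrite -mulnA leq_pmul2l // expn_gt0 a0.
Qed.

Lemma mem_pair_vars n (G : seq (pair_clause n)) g :
  g \in G -> (val g.1.1 \in pair_vars G) && (val g.2.1 \in pair_vars G).
Proof.
move=> gG; rewrite !mem_cat (map_f (fun g : pair_clause n => val g.1.1) gG).
by rewrite (map_f (fun g : pair_clause n => val g.2.1) gG) orbT.
Qed.

(** Models of [G] satisfy its sublist [hs], and (3/4)^l decreases with l, so a matching larger than
    [L] still gives the bound for [L]. *)
Lemma card_sat_matching n (G hs : seq (pair_clause n)) L :
  {subset hs <= G} -> L <= size hs ->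
  4 ^ size hs * #|[set a | all (pair_val a) hs]| = 3 ^ size hs * 2 ^ n ->
  4 ^ L * #|[set a | all (pair_val a) G]| <= 3 ^ L * 2 ^ n.
Proof.
move=> sub leL E.
have le : #|[set a | all (pair_val a) G]| <= #|[set a | all (pair_val a) hs]|.
  by apply/subset_leq_card/subsetP => a; rewrite !inE => /allP aG; apply/allP => g /sub /aG.
have h : size hs = L + (size hs - L) by lia.
rewrite -(leq_pmul2l (m := 4 ^ (size hs - L))) ?expn_gt0 //.
rewrite mulnA -expnD addnC -h.
apply: leq_trans (leq_mul (leqnn _) le) _.
rewrite E {1}h expnD mulnAC mulnC leq_mul //.
by case: (size hs - L) => // r; rewrite leq_exp2r.
Qed.

(** * Parsing *)

(* The program's arrays.  [branch] holds the values given to the matched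
   variables, [propagated] those after unit propagation, both encoded as for
   [agree]; scalars live at index 0. *)
Notation answer := 1 (only parsing).
Notation bits := 2 (only parsing).
Notation tree := 3 (only parsing).
Notation fst_var := 4 (only parsing).
Notation fst_sign := 5 (only parsing).
Notation snd_var := 6 (only parsing).
Notation snd_sign := 7 (only parsing).
Notation branch := 8 (only parsing).
Notation matched := 9 (only parsing).
Notation propagated := 10 (only parsing).
Notation idx := 12 (only parsing).
Notation pos := 13 (only parsing).
Notation empty_seen := 14 (only parsing).
Notation nmatched := 15 (only parsing).
Notation tree_pos := 16 (only parsing).
Notation len_pos := 17 (only parsing).
Notation consistent := 18 (only parsing).
Notation nset := 19 (only parsing).
Notation bit_pos := 20 (only parsing).
Notation deficit := 21 (only parsing).
Notation nlits := 22 (only parsing).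

Notation num := EConst (only parsing).
Notation cell_at a i := (EGet a (var i)) (only parsing).
Notation nvars := (EGet 0 (num 0)) (only parsing).
Notation nclauses := (EGet 0 (num 1)) (only parsing).

Definition formula_arrays n (G : seq (pair_clause n)) (mu : memory) : Prop :=
  [/\ mu 0 0 = n, mu 0 1 = size G &
    forall j g, onth G j = Some g ->
    [/\ mu fst_var j = g.1.1, mu fst_sign j = g.1.2,
        mu snd_var j = g.2.1 & mu snd_sign j = g.2.2]].

Lemma formula_arrays_frame n (G : seq (pair_clause n)) S mu mu' :
  frame S mu mu' -> ~~ has (mem S) [:: 0; 4; 5; 6; 7] ->
  formula_arrays G mu -> formula_arrays G mu'.
Proof.
rewrite /= orbF !negb_or => f /and5P[n0 n4 n5 n6 n7] [mn mm mg].
by split=> [||j g /mg[]]; rewrite !f //.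
Qed.

Lemma modn_bool w (b : bool) : 1 < 2 ^ w -> b %% 2 ^ w = b.
Proof. by move=> w1; rewrite modn_small //; case: b => //; apply: ltnW. Qed.

(* Clauses of size 1 are stored as pairs of equal literals. *)
Definition pair_of n (c : clause n) : option (pair_clause n) :=
  if c is l :: c' then Some (l, last l c') else None.

Lemma pairs_of_cnf n (F : cnf n) : ~~ has (@nilp _) F ->
  map Some (pmap (@pair_of n) F) = map (@pair_of n) F.
Proof.
by elim: F => //= -[|l c] F IH //= /IH ->.
Qed.

Lemma pairs_val n (F : cnf n) a : is_kcnf 2 F -> ~~ has (@nilp _) F ->
  all (pair_val a) (pmap (@pair_of n) F) = cnf_val a F.
Proof.
elim: F => //= c F IH /andP[lec kF]; rewrite negb_or => /andP[c0 /(IH kF) <-].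
by case: c lec c0 => [|l [|l' [|]]] //= _ _; rewrite /pair_val /clause_val /= ?orbF ?orbb.
Qed.

(** The second literal is read back from the end of the clause, after [pos] has moved past it, so a
    clause of size 1 gets its only literal twice without a test. For an empty clause the values read
    are meaningless, but [empty_seen] is raised and the program rejects. *)
Definition parse_clause : cmd := block [::
  set_var empty_seen
    (ELt (num 0) (EAdd (var empty_seen) (EEq (cell_at 0 pos) (num 0))));
  CSet fst_var (var idx) (EGet 0 (EAdd (var pos) (num 1)));
  CSet fst_sign (var idx) (EGet 0 (EAdd (var pos) (num 2)));
  set_var pos (EAdd (var pos)
    (EAdd (num 1) (EAdd (cell_at 0 pos) (cell_at 0 pos))));
  CSet snd_var (var idx) (EGet 0 (ESub (var pos) (num 2)));
  CSet snd_sign (var idx) (EGet 0 (ESub (var pos) (num 1)))].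

Definition parse : cmd :=
  CSeq (set_var pos (num 2)) (for_loop idx nclauses parse_clause).

Lemma size_encode_literals n (c : clause n) :
  size (encode_literals c) = (2 * size c).+1.
Proof. by rewrite /=; elim: c => //= l c; lia. Qed.

Lemma encode_cnf_clause n (F : cnf n) k c :
  onth F k = Some c ->
  let p := 2 + size (flatten [seq encode_literals c | c <- take k F]) in
  p + size (encode_literals c) =
    2 + size (flatten [seq encode_literals c | c <- take k.+1 F]) /\
  forall i, i < size (encode_literals c) ->
    nth 0 (encode_cnf F) (p + i) = nth 0 (encode_literals c) i.
Proof.
move=> Fk p; have tk := onth_take_rcons Fk; split.
  by rewrite tk map_rcons flatten_rcons size_cat addnA.
move=> i lti; rewrite /encode_cnf -[in LHS](cat_take_drop k.+1 F) tk.
rewrite map_cat map_rcons flatten_cat flatten_rcons /p -addnA [LHS]/=.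
rewrite add0n -catA nth_cat.
by rewrite ltnNge leq_addr addKn nth_cat lti.
Qed.

Lemma parse_correct n (F : cnf n) w :
  is_kcnf 2 F -> 16 * (n + size F).+1 <= 2 ^ w ->
  runs w parse (input_memory F) (80 * (size F).+1) (fun mu =>
    [/\ mu empty_seen 0 = has (@nilp _) F,
        ~~ has (@nilp _) F -> formula_arrays (pmap (@pair_of n) F) mu &
        frame [:: 4; 5; 6; 7; 12; 13; 14] (input_memory F) mu]).
Proof.
move=> kF Hw; set m := size F in Hw *.
have W1 : 1 < 2 ^ w by lia.
have W2 : 2 < 2 ^ w by lia.
(* The offset of clause [k], behind the two header cells. A clause takes at most 1 + 2 * 2 = 5
   cells, so all offsets fit in a word. *)
set posn := fun k => 2 + size (flatten [seq encode_literals c | c <- take k F]).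
have le_posn k c : onth F k = Some c -> posn k.+1 <= posn k + 5.
  move=> Fk; have [E _] := encode_cnf_clause Fk.
  rewrite /posn -E size_encode_literals.
  have : c \in F by apply/onthP; exists k.
  by move/(allP kF); lia.
have posn_le k : k <= m -> posn k <= 2 + 5 * k.
  elim: k => [|k IH] ltk; first by rewrite /posn take0.
  have [c Fk] := onth_size ltk; have := le_posn _ _ Fk; have := IH (ltnW ltk).
  by lia.
pose I k (mu : memory) := [/\ mu idx 0 = k /\ k <= m, mu 0 =1 input_memory F 0,
   mu pos 0 = posn k, mu empty_seen 0 = has (@nilp _) (take k F) &
   forall j l c, j < k -> onth F j = Some (l :: c) ->
   [/\ mu fst_var j = l.1, mu fst_sign j = l.2,
        mu snd_var j = (last l c).1 & mu snd_sign j = (last l c).2]].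
have R : runs w parse (input_memory F) (80 * m.+1) (fun mu => I m mu).
  apply: (@runs_seq _ _ _ _ 3 (80 * m + 50)); last by lia.
  apply: runs_sem => //=; rewrite mod0n modn_small //.
  apply: (@runs_for _ m 60 I) => //; try lia.
  - by rewrite /I /update /= /posn take0.
  - by move=> k mu [[-> le] m0 _ _ _]; split; rewrite //= modn_small // m0.
  - move=> k mu ltk [[ik lek] m0 pk bk arr].
    have [c Fk] := onth_size ltk; have [Pk rd] := encode_cnf_clause Fk.
    rewrite -/(posn k) -/(posn k.+1) size_encode_literals in Pk rd.
    have lec : size c <= 2 by apply: (allP kF); apply/onthP; exists k.
    have := posn_le _ ltk; move=> le5.
    have rd0 : mu 0 (posn k) = size c.
      by rewrite m0 -[posn k]addn0 -[LHS]/(nth 0 (encode_cnf F) _) rd.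
    apply: runs_sem; [by []|by []|]; rewrite /parse_clause.
    set p := posn k in Pk rd rd0 pk.
    have bk' : has (@nilp _) (take k.+1 F) = (0 < has (@nilp _) (take k F) + (size c == 0)).
      by rewrite (onth_take_rcons Fk) has_rcons /nilp; case: (_ == 0); case: has.
    assign 0 (has (@nilp _) (take k.+1 F) : nat) (ik, pk, bk, rd0, bk').
    assign k (mu 0 (p + 1)) (ik, pk).
    assign k (mu 0 (p + 2)) (ik, pk).
    assign 0 (posn k.+1) (ik, pk, rd0).
    assign k (mu 0 (posn k.+1 - 2)) (ik, pk).
    assign k (mu 0 (posn k.+1 - 1)) (ik, pk).
    rewrite /= /I /update /=; split=> //; split=> // j l c' ltj Fj.
    case: (eqVneq j k) => [jk | nejk]; last first.
      by apply: arr Fj; move: nejk ltj; rewrite ltnS leq_eqVlt => /negPf->.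
    move: Fj; rewrite jk Fk => -[Ec]; rewrite Ec in lec Pk rd; rewrite !m0 -Pk.
    have sub2 : p + (2 * size (l :: c')).+1 - 2 = p + (2 * size c').+1 by rewrite /=; lia.
    have sub1 : p + (2 * size (l :: c')).+1 - 1 = p + (2 * size c').+2 by rewrite /=; lia.
    rewrite sub1 sub2 -![input_memory F 0 _]/(nth 0 (encode_cnf F) _) !rd ?/=; try lia.
    by case: c' {Ec Pk rd ltj sub1 sub2} lec => [|l' [|]].
  - by rewrite /=; lia.
apply: runs_weaken (runs_frame (S := [:: 4; 5; 6; 7; 12; 13; 14]) _ R) _ _ => //.
move=> mu [fr [_ m0 _ bE arr]]; rewrite take_size in bE; split=> // noempty.
have sz : size (pmap (@pair_of n) F) = m.
  by rewrite -[LHS](size_map Some) pairs_of_cnf // size_map.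
split=> [||j g Gj]; rewrite ?m0 ?sz //.
have : onth (map Some (pmap (@pair_of n) F)) j = Some (Some g).
  by rewrite onth_map Gj.
rewrite pairs_of_cnf // onth_map.
case Fj: (onth F j) => [[|l c]|] //= [<-] /=.
by apply: (arr j l c); rewrite // -onthTE Fj.
Qed.

(** * Greedy matching *)

(** In this phase [branch] is a membership mark for the matched variables. The test also discards
    clauses on a single variable, which would not contribute the factor 3/4. *)
Definition match_clause : cmd :=
  CIf (EAdd (EAdd (EGet branch (cell_at fst_var idx)) (EGet branch (cell_at snd_var idx)))
        (EEq (cell_at fst_var idx) (cell_at snd_var idx)))
    CSkip
    (block [::
      CSet matched (var nmatched) (cell_at fst_var idx);
      CSet matched (EAdd (var nmatched) (num 1)) (cell_at snd_var idx);
      CSet branch (cell_at fst_var idx) (num 1);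
      CSet branch (cell_at snd_var idx) (num 1);
      set_var nmatched (EAdd (var nmatched) (num 2))]).

Definition match_clauses : cmd := for_loop idx nclauses match_clause.

(** Only the zero pattern of [branch] is fixed, not its values, so that the property survives the
    branching phase. *)
Definition matched_vars n (G : seq (pair_clause n)) (xs : seq 'I_n) (mu : memory) :=
  [/\ mu nmatched 0 = size xs,
      forall j x, onth xs j = Some x -> mu matched j = x,
      forall x : 'I_n, (mu branch x != 0) = (x \in xs) &
      forall x, x \notin pair_vars G -> mu branch x = 0].

(** A clause on one variable counts as covered because it is a single literal or a tautology. *)
Definition covers n (xs : seq 'I_n) (g : pair_clause n) : bool :=
  [|| g.1.1 \in xs, g.2.1 \in xs | g.1.1 == g.2.1].

Definition sat_fraction n (hs : seq (pair_clause n)) : Prop :=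
  4 ^ size hs * #|[set a | all (pair_val a) hs]| = 3 ^ size hs * 2 ^ n.

Lemma match_clauses_correct n (G : seq (pair_clause n)) w mu :
  16 * (n + size G).+1 <= 2 ^ w ->
  formula_arrays G mu -> mu branch =1 (fun=> 0) -> mu nmatched 0 = 0 ->
  runs w match_clauses mu (80 * (size G).+1) (fun mu' =>
    [/\ frame [:: 8; 9; 12; 15] mu mu' &
    exists xs, [/\ uniq xs, matched_vars G xs mu', all (covers xs) G, size xs <= 2 * size G
      & forall L, 2 * L <= size xs ->
        4 ^ L * #|[set a | all (pair_val a) G]| <= 3 ^ L * 2 ^ n]]).
Proof.
move=> Hw FA M0 d0; set m := size G in Hw *.
(* The chosen clauses [hs] are a ghost: the program stores only their variables. The marks are
   exactly 0 or 1 here, which keeps the tested sum within a word. *)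
pose I k (mu1 : memory) := [/\ mu1 idx 0 = k /\ k <= m, formula_arrays G mu1 &
  exists (xs : seq 'I_n) (hs : seq (pair_clause n)), [/\ matched_vars G xs mu1, uniq xs /\ (forall x : 'I_n, mu1 branch x = (x \in xs)),
    [/\ {subset hs <= G}, {subset pair_vars hs <= map val xs},
      size xs = 2 * size hs & size hs <= k],
    sat_fraction hs &
    all (covers xs) (take k G)]].
have R : runs w match_clauses mu (80 * m.+1) (I m).
  apply: (@runs_for _ m 60 I) => //; try lia.
  - rewrite /I /update /=; split=> //.
    exists [::], [::]; rewrite take0; split=> //.
      by split=> // [j x|x|x _]; rewrite ?onth0n //= M0.
    by rewrite /sat_fraction /= !mul1n -card_assignment -cardsT; apply: eq_card => a; rewrite !inE.
  - by move=> k mu1 [[-> le] [_ mm _] _]; split; rewrite //= modn_small ?mm //; lia.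
  - move=> k mu1 ltk [[ik lek] FA1 [xs [hs [MV [Uxs Mx] [subG subx szx szh] cnt cov]]]].
    have [g Gk] := onth_size ltk; have [mn mm /(_ _ _ Gk)[v1 s1 v2 s2]] := FA1.
    have gG : g \in G by apply/onthP; exists k.
    have [szE mtch brE br0] := MV.
    have tk := onth_take_rcons Gk.
    apply: runs_sem; [by []|by []|].
    have ev : eval w mu1 (EAdd (EAdd (EGet branch (cell_at fst_var idx))
        (EGet branch (cell_at snd_var idx))) (EEq (cell_at fst_var idx) (cell_at snd_var idx))) =
        (g.1.1 \in xs) + (g.2.1 \in xs) + (val g.1.1 == val g.2.1).
      by evaluate (ik, v1, v2, Mx).
    case cg: (covers xs g).
      rewrite sem_true; last first.
        by rewrite ev; case/or3P: (cg) => [->|->|/eqP->]; rewrite ?eqxx; arith.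
      rewrite /I /update /=; split=> //; split=> //; exists xs, hs.
      by split=> //; [split=> //; lia | rewrite tk all_rcons cg].
    have [n1 n2 ne] : [/\ g.1.1 \notin xs, g.2.1 \notin xs & g.1.1 != g.2.1].
      by move: cg; rewrite /covers; case: (_ \in _); case: (_ \in _); case: (_ == _).
    rewrite sem_false; last first.
      by rewrite ev (negPf n1) (negPf n2) val_eqE (negPf ne).
    assign (size xs) (val g.1.1) (ik, v1, szE).
    assign (size xs).+1 (val g.2.1) (ik, v2, szE).
    assign (val g.1.1) 1 (ik, v1, szE).
    assign (val g.2.1) 1 (ik, v2, szE).
    assign 0 (size xs + 2) (ik, v2, szE).
    rewrite /= /I /update /=; split=> //; split=> //.
    exists (xs ++ [:: g.1.1; g.2.1]), (rcons hs g).
    have Mx' (y : 'I_n) : (if val y == val g.2.1 then 1 else if val y == val g.1.1 then 1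
        else mu1 branch y) = (y \in xs ++ [:: g.1.1; g.2.1]).
      rewrite mem_cat !inE !val_eqE Mx.
      by case: (y == g.1.1); case: (y == g.2.1); case: (y \in xs).
    have /andP[pv1 pv2] := mem_pair_vars gG.
    split; last 1 first.
    + rewrite tk all_rcons {1}/covers mem_cat !inE eqxx orbT /=.
      apply: sub_all cov => g'; rewrite /covers !mem_cat.
      by case/or3P=> ->; rewrite ?orbT.
    + split; first by rewrite size_cat addn2.
      * move=> j x; rewrite onth_cat; case: ltnP => ltj.
          by move=> /mtch <- /=; rewrite !ltn_eqF // ltnW.
        case Ej: (j - size xs) => [|[|r]] /=; last by rewrite onth0n.
          have -> : j = size xs by apply/eqP; rewrite eqn_leq ltj -subn_eq0 Ej.
          by rewrite eqxx ltn_eqF //; case=> ->.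
        have -> : j = (size xs).+1 by rewrite -(subnK ltj) Ej.
        by rewrite eqxx; case=> ->.
      * move=> y; apply: etrans (congr1 (fun v => v != 0) (Mx' y)) _.
        by case: (y \in _).
      * move=> y ny /=; case: eqP => [ex|_]; first by rewrite ex pv2 in ny.
        by case: eqP => [ex|_]; [rewrite ex pv1 in ny | apply: br0].
    + split=> [|y]; last exact: Mx'.
      by rewrite cat_uniq Uxs /= orbF negb_or n1 n2 inE ne.
    + split.
      * by move=> h; rewrite mem_rcons inE => /predU1P[->//|/subG].
      * move=> x; rewrite /pair_vars !map_rcons mem_cat !mem_rcons !inE map_cat mem_cat /=.
        rewrite !inE => /orP[/orP[/eqP->|xh]|/orP[/eqP->|xh]]; rewrite ?eqxx ?orbT //.
          by rewrite subx // mem_cat xh.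
        by rewrite subx // mem_cat xh orbT.
      * by rewrite size_cat size_rcons szx /=; arith.
      * by rewrite size_rcons.
    (* All variables of [hs] are matched, so the new clause is disjoint from them and multiplies the
       number of models by 3/4. *)
    + have nh x : x \notin xs -> val x \notin pair_vars hs.
        by apply: contra => /subx; rewrite mem_map //; apply: val_inj.
      have E := card_disjoint_clause ne (nh _ n1) (nh _ n2).
      rewrite /sat_fraction in cnt *; rewrite size_rcons !expnS mulnAC E.
      by rewrite -!mulnA -cnt [4 ^ _ * _]mulnC.
  - by rewrite /=; lia.
apply: runs_weaken (runs_frame (S := [:: 8; 9; 12; 15]) _ R) _ _ => //.
move=> mu' [fr [_ _ [xs [hs [MV [Uxs _] [subG _ szx szh] cnt cov]]]]]; split=> //.
exists xs; split=> //; first by rewrite -[G]take_size.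
  by rewrite szx leq_mul2l.
by move=> L; rewrite szx leq_mul2l => leL; apply: card_sat_matching cnt.
Qed.

(** * Leaves *)

Definition add_bit : cmd :=
  CSeq (set_var bit_pos (ESub nvars (var nset)))
  (CSeq (CWhile (cell_at bits bit_pos) (block [::
          CSet bits (var bit_pos) (num 0);
          set_var bit_pos (EAdd (var bit_pos) (num 1))]))
    (CSet bits (var bit_pos) (num 1))).

(** Only the bits from [n - s] to [n] may be nonzero; [i + s < n] avoids truncated subtraction. *)
Definition counter (n s : nat) (c : nat -> nat) (V : nat) : Prop :=
  [/\ forall i, c i <= 1, binval n c = V & forall i, i + s < n -> c i = 0].

Lemma counter_ext n s c c' V : c' =1 c -> counter n s c V -> counter n s c' V.
Proof.
move=> cc [c1 cV c0]; split=> [i||i lti]; rewrite ?cc //; last exact: c0.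
by rewrite -cV; apply: eq_bigr => i _; rewrite cc.
Qed.

(** The stored value plus the pending carry [2 ^ (p + k)] stays equal to [V + 2 ^ p]. As this sum is
    at most [2 ^ n], the carry settles at position [n] at the latest, after at most [q] steps. *)
Lemma add_bit_correct n s w mu V q :
  16 * n.+1 <= 2 ^ w -> mu 0 0 = n -> mu nset 0 = q -> q <= n -> q <= s ->
  counter n s (mu bits) V -> V + 2 ^ (n - q) <= 2 ^ n ->
  runs w add_bit mu (30 * s.+1)
    (fun mu' => counter n s (mu' bits) (V + 2 ^ (n - q))).
Proof.
move=> Hw m0 mq qn qs [c1 cV c0] leV; set p := n - q in leV *.
have W1 : 1 < 2 ^ w by lia.
pose J k (mu1 : memory) := [/\ mu1 bit_pos 0 = p + k, p + k <= n,
   forall i, mu1 bits i <= 1, forall i, i + s < n -> mu1 bits i = 0 &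
   binval n (mu1 bits) + 2 ^ (p + k) = V + 2 ^ p].
apply: (@runs_seq _ _ _ _ 7 (23 * s.+1)); last by lia.
apply: runs_sem; [by []|by []|].
rewrite (_ : sem _ _ _ = update mu bit_pos 0 p); last first.
  by rewrite /= mod0n m0 mq.
apply: (@runs_seq _ _ _ _ (20 * s + 4) 5); last by lia.
apply: (@runs_while _ q 12 J); last by rewrite /=; lia.
  by rewrite /J /update /= addn0; split=> //; rewrite ?cV // /p leq_subr.
move=> k mu1 [pk lek b1 b0 bV].
have -> : eval w mu1 (cell_at bits bit_pos) = mu1 bits (p + k) by rewrite /= mod0n pk.
case: (eqVneq (mu1 bits (p + k)) 0) => [z | nz]; [left | right].
  split=> //; apply: runs_sem; [by []|by []|].
  rewrite (_ : sem _ _ _ = update mu1 bits (p + k) 1); last first.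
    by rewrite /= mod0n modn_small // pk.
  rewrite /update /=; split=> [i|| i lti].
  - by case: (i == _).
  - have := @binval_set n (mu1 bits) _ (p + k) 1 lek (fun i => erefl).
    by rewrite z; lia.
  - by rewrite ltn_eqF ?b0 //; rewrite /p; lia.
have one : mu1 bits (p + k) = 1 by have := b1 (p + k); lia.
(* A one at position [n] together with a pending carry [2 ^ n] would exceed the sum. *)
have ltk : p + k < n.
  rewrite ltn_neqAle lek andbT; apply/eqP => pkn.
  have := binval_ge (mu1 bits) lek; rewrite one mul1n.
  have : 0 < 2 ^ p by rewrite expn_gt0.
  by rewrite pkn in bV *; lia.
split=> //; first by rewrite /p in ltk; lia.
apply: runs_sem; [by []|by []|].
assign (p + k) 0 (pk, mod0n).
assign 0 (p + k.+1) (pk, mod0n).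
rewrite /= /J /update /= addnS; split=> // [i|i lti|].
- by case: (i == _).
- by case: (i == _) => //; apply: b0.
- have := @binval_set n (mu1 bits) _ (p + k) 0 lek (fun i => erefl).
  by rewrite one expnS; lia.
Qed.

(** A literal that gets here is not satisfied, so a nonzero cell holds the opposite value: a
    conflict. The literal is output in that case too, which makes the 1-CNF false along the whole
    path; no special leaf for a contradiction is needed. *)
Definition emit_literal (va sa : nat) : cmd :=
  CSeq (CIf (EGet propagated (cell_at va idx))
      (block [:: set_var consistent (num 0)])
      (block [:: CSet propagated (cell_at va idx) (EAdd (cell_at sa idx) (num 1));
                 set_var nset (EAdd (var nset) (num 1))]))
    (block [:: CSet tree (var tree_pos) (cell_at va idx);
               CSet tree (EAdd (var tree_pos) (num 1)) (cell_at sa idx);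
               set_var tree_pos (EAdd (var tree_pos) (num 2));
               set_var nlits (EAdd (var nlits) (num 1))]).

Definition satisfied (va sa : nat) : expr :=
  EEq (EGet propagated (cell_at va idx)) (EAdd (cell_at sa idx) (num 1)).

(** Once neither literal is satisfied, an assigned variable means a falsified literal and the other
    literal is forced. If both variables are unassigned, covering makes them equal: equal signs
    force the literal, opposite signs give a tautology. *)
Definition scan_clause : cmd :=
  CIf (satisfied fst_var fst_sign) CSkip
  (CIf (satisfied snd_var snd_sign) CSkip
  (CIf (EGet propagated (cell_at fst_var idx)) (emit_literal snd_var snd_sign)
  (CIf (EGet propagated (cell_at snd_var idx)) (emit_literal fst_var fst_sign)
  (CIf (EEq (cell_at fst_sign idx) (cell_at snd_sign idx))
    (emit_literal fst_var fst_sign) CSkip)))).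

Definition scan : cmd := for_loop idx nclauses scan_clause.

(** Copying at the variables of clauses is enough, since elsewhere both arrays are 0. *)
Definition reset_clause : cmd := block [::
  CSet propagated (cell_at fst_var idx) (EGet branch (cell_at fst_var idx));
  CSet propagated (cell_at snd_var idx) (EGet branch (cell_at snd_var idx))].

Definition reset : cmd := for_loop idx nclauses reset_clause.

(** The number of literals is known only after the scan, so its cell is reserved at [len_pos] and
    filled later. [nset] starts at [nmatched], as all matched variables are assigned at a leaf. *)
Definition leaf : cmd :=
  CSeq reset
  (CSeq (block [:: CSet tree (var tree_pos) (num 0);
                   set_var len_pos (EAdd (var tree_pos) (num 1));
                   set_var tree_pos (EAdd (var tree_pos) (num 2));
                   set_var nlits (num 0);
                   set_var consistent (num 1);
                   set_var nset (var nmatched)])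
  (CSeq scan
  (CSeq (CSet tree (var len_pos) (var nlits))
    (CIf (var consistent) add_bit CSkip)))).

(** * Invariant of unit propagation *)

Definition emitted n (p : nat) (ls : seq (literal n)) (t : nat -> nat) : Prop :=
  forall i, i < 2 * size ls ->
    t (p + i) = nth 0 (flatten [seq encode_literal l | l <- ls]) i.

Lemma size_encode_literal n (ls : seq (literal n)) :
  size (flatten [seq encode_literal l | l <- ls]) = 2 * size ls.
Proof. by have [] := size_encode_literals ls. Qed.

Lemma emitted_rcons n p (ls : seq (literal n)) (l : literal n) (t t' : nat -> nat) :
  emitted p ls t -> (forall i, i < p + 2 * size ls -> t' i = t i) ->
  t' (p + 2 * size ls) = l.1 -> t' (p + 2 * size ls).+1 = l.2 ->
  emitted p (rcons ls l) t'.
Proof.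
move=> em tt t1 t2 i; rewrite size_rcons mulnS => lti.
rewrite map_rcons flatten_rcons nth_cat size_encode_literal.
case: ltnP => [lt | ge]; first by rewrite tt ?ltn_add2l // em.
case Ei: (i - 2 * size ls) => [|[|r]] /=.
- by rewrite (_ : i = 2 * size ls) //; lia.
- by rewrite (_ : i = (2 * size ls).+1) ?addnS //; lia.
- by lia.
Qed.

Section Leaf.

Variables (n : nat) (G : seq (pair_clause n)).

(* The 1-CNF [ls] and the partial assignment [R] obtained from [r] by unit
   propagation through the clauses [Gk]; [ok = false] records a conflict. *)
Definition scan_state (r : nat -> nat) (Gk : seq (pair_clause n))
    (ls : seq (literal n)) (R : nat -> nat) (ok : nat) (q : nat) : Prop :=
  [/\ forall a : assignment n, agree r a ->
        all (literal_val a) ls = all (pair_val a) Gk,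
      forall a : assignment n, agree r a ->
        all (literal_val a) ls = (ok != 0) && agree R a,
      forall x, r x <> 0 -> R x = r x,
      forall x, x \notin pair_vars G -> R x = 0 &
      2 ^ q * #|[set a : assignment n | agree R a]| = 2 ^ n].

Lemma scan_skip r Gk ls R ok q g :
  scan_state r Gk ls R ok q ->
  (forall a : assignment n, agree r a -> agree R a -> pair_val a g) ->
  scan_state r (rcons Gk g) ls R ok q.
Proof.
move=> [A B ext vars cnt] sat; split=> // a ra; rewrite all_rcons -(A a ra).
by have := B a ra; case: (all _ ls); rewrite ?andbF // => /esym/andP[_ /(sat a ra) ->].
Qed.

(** Where [r] and [R] hold, the clause reduces to [l]. A free variable extends [R] at the price of
    half of its assignments; a variable with the opposite value makes [R] and [l] incompatible,
    whence the flag 0. *)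
Lemma scan_emit r Gk ls R ok q g (l : literal n) :
  scan_state r Gk ls R ok q -> val l.1 \in pair_vars G ->
  (forall a : assignment n, agree r a -> agree R a -> pair_val a g = literal_val a l) ->
  (forall R' : nat -> nat, R l.1 = 0 -> (forall y, R' y = if y == l.1 then l.2.+1 else R y) ->
    scan_state r (rcons Gk g) (rcons ls l) R' ok q.+1) /\
  (R l.1 <> 0 -> R l.1 <> l.2.+1 -> scan_state r (rcons Gk g) (rcons ls l) R 0 q).
Proof.
move=> [A B ext vars cnt] lG eqv.
have A' a : agree r a ->
    all (literal_val a) (rcons ls l) = all (pair_val a) (rcons Gk g).
  move=> ra; rewrite !all_rcons -(A a ra).
  by have := B a ra; case: (all _ ls); rewrite ?andbF // => /esym/andP[_ /(eqv a ra) ->].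
split=> [R' R0 R'E | Rn Rl]; split=> //.
- move=> a ra; rewrite all_rcons (B a ra) (agree_set a R0 (fun y => R'E y)).
  by rewrite andbC -andbA.
- move=> x rx; rewrite R'E; case: eqP => [xl|_]; last exact: ext.
  by case: (rx); rewrite -(ext x rx) xl.
- move=> x nx; rewrite R'E; case: eqP => [xl|_]; last exact: vars.
  by rewrite xl lG in nx.
- by rewrite -cnt -(card_agree_set R0 (fun y => R'E y)) expnSr mulnA.
- move=> a ra; rewrite all_rcons (B a ra) /=.
  by case Ra: (agree R a); rewrite ?andbF // (agree_neq Ra).
Qed.

Definition leaf_inv (r T0 : nat -> nat) (p d k : nat) (mu : memory) : Prop :=
  [/\ mu idx 0 = k /\ k <= size G, formula_arrays G mu,
      forall i, i < p -> mu tree i = T0 i &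
      exists ls, [/\ size ls <= k /\ mu consistent 0 <= 1, mu nlits 0 = size ls,
        mu tree_pos 0 = p + 2 * size ls /\ mu nset 0 <= d + k,
        emitted p ls (mu tree) &
        scan_state r (take k G) ls (mu propagated) (mu consistent 0) (mu nset 0)]].

Variables (w p d : nat) (r T0 : nat -> nat).
Hypothesis (Hw : 16 * (n + size G + d).+1 <= 2 ^ w).
Hypothesis (Hp : p + 2 * size G < 2 ^ w).

Lemma emit_literal_correct k mu va sa g (l : literal n) :
  leaf_inv r T0 p d k mu -> onth G k = Some g ->
  va = fst_var /\ sa = fst_sign \/ va = snd_var /\ sa = snd_sign ->
  mu va k = l.1 -> mu sa k = l.2 -> val l.1 \in pair_vars G ->
  (forall a : assignment n, agree r a -> agree (mu propagated) a ->
     pair_val a g = literal_val a l) ->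
  mu propagated l.1 <> l.2.+1 ->
  leaf_inv r T0 p d k.+1 (update (sem w (emit_literal va sa) mu) idx 0 k.+1).
Proof.
move=> [[ik lek] FA pre [ls [[szl c1] nl [tp ns] em sc]]] Gk vs ml1 ml2 lG eqv unsat.
have W1 : 1 < 2 ^ w by lia.
have ltk : k < size G by rewrite -onthTE Gk.
have tk := onth_take_rcons Gk; have [set_l conf_l] := scan_emit sc lG eqv.
rewrite /emit_literal sem_seq.
have lb : (l.2 : nat) <= 1 by case: (l.2).
(* Both outcomes of the test end with the same output code, treated here for any memory reached by
   the first half. *)
have fin mu2 : frame [:: propagated; consistent; nset] mu mu2 ->
    mu2 consistent 0 <= 1 -> mu2 nset 0 <= d + k.+1 ->
    scan_state r (take k.+1 G) (rcons ls l) (mu2 propagated) (mu2 consistent 0) (mu2 nset 0) ->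
    leaf_inv r T0 p d k.+1 (update (sem w (block [::
      CSet tree (var tree_pos) (cell_at va idx);
      CSet tree (EAdd (var tree_pos) (num 1)) (cell_at sa idx);
      set_var tree_pos (EAdd (var tree_pos) (num 2));
      set_var nlits (EAdd (var nlits) (num 1))]) mu2) idx 0 k.+1).
  move=> fr c2 n2 sc2.
  have FA2 := formula_arrays_frame fr isT FA.
  have ik2 : mu2 idx 0 = k by rewrite fr.
  have tp2 : mu2 tree_pos 0 = p + 2 * size ls by rewrite fr.
  have nl2 : mu2 nlits 0 = size ls by rewrite fr.
  have [va2 sa2] : mu2 va k = l.1 /\ mu2 sa k = l.2.
    by case: vs ml1 ml2 => -[-> ->]; rewrite !fr.
  have {}va2 : mu2 va k = l.1 /\ mu2 sa k = l.2 /\ va != tree /\ sa != tree.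
    by case: vs va2 sa2 => -[-> ->].
  case: va2 => va2 [_ [nva nsa]].
  assign (p + 2 * size ls) (val l.1) (ik2, va2, tp2).
  assign (p + 2 * size ls).+1 (nat_of_bool l.2) (ik2, sa2, tp2, negPf nva, negPf nsa).
  assign 0 (p + 2 * (size ls).+1) (ik2, tp2).
  assign 0 (size ls).+1 (ik2, tp2, nl2).
  rewrite /= /leaf_inv /update /=; split=> //.
    by move=> i lti; rewrite !ltn_eqF ?fr ?pre //; lia.
  exists (rcons ls l); rewrite size_rcons; split=> //.
  apply: emitted_rcons em _ _ _ => [i lti||]; rewrite ?eqxx //.
    by rewrite !ltn_eqF ?fr //; lia.
  by rewrite ltn_eqF.
case: (eqVneq (mu propagated l.1) 0) => [R0 | Rn].
  rewrite sem_false; last by case: vs ml1 ml2 => -[-> ->] ml1 ml2; evaluate (ik, ml1).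
  set mu2 := sem w (block (CSet propagated _ _ :: _)) _.
  have -> : mu2 = update (update mu propagated l.1 l.2.+1) nset 0 (mu nset 0).+1.
    rewrite /mu2; case: vs ml1 ml2 => -[-> ->] ml1 ml2.
      assign (val l.1) l.2.+1 (ik, ml1, ml2).
      by assign 0 (mu nset 0).+1 (ik, ml1, ml2).
    assign (val l.1) l.2.+1 (ik, ml1, ml2).
    by assign 0 (mu nset 0).+1 (ik, ml1, ml2).
  apply: fin => //; try by rewrite /update /=; lia.
    by move=> a i; rewrite !inE !negb_or /update => /and3P[/negPf-> _ /negPf->].
  by rewrite tk; apply: (set_l (update mu propagated l.1 l.2.+1 propagated)).
rewrite sem_true; last first.
  by move/eqP: Rn; case: vs ml1 ml2 => -[-> ->] ml1 ml2; rewrite /= mod0n ik ml1.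
set mu2 := sem w (block [:: set_var consistent _]) _.
have -> : mu2 = update mu consistent 0 0 by rewrite /mu2; assign 0 0 ik.
apply: fin => //.
- by move=> a i; rewrite !inE !negb_or /update => /and3P[_ /negPf-> _].
- by rewrite /update /=; lia.
- by rewrite tk; apply: conf_l => //; apply/eqP.
Qed.

Hypothesis cov : forall g, g \in G -> r g.1.1 = 0 -> r g.2.1 = 0 -> g.1.1 = g.2.1.

Lemma scan_clause_correct k mu :
  leaf_inv r T0 p d k mu -> k < size G ->
  leaf_inv r T0 p d k.+1 (update (sem w scan_clause mu) idx 0 k.+1).
Proof.
move=> inv ltk; have [[ik lek] FA pre [ls [[szl c1] nl tp em sc]]] := inv.
have W1 : 1 < 2 ^ w by lia.
have [g Gk] := onth_size ltk; have tk := onth_take_rcons Gk.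
have gG : g \in G by apply/onthP; exists k.
have /andP[g1G g2G] := mem_pair_vars gG.
have [mn mm /(_ _ _ Gk)[v1 s1 v2 s2]] := FA.
have [_ _ ext _ _] := sc.
have bsm (l : literal n) : (l.2 : nat) <= 1 by case: (l.2).
have b1 := bsm g.1; have b2 := bsm g.2.
have ev1 : eval w mu (satisfied fst_var fst_sign) = (mu propagated g.1.1 == g.1.2.+1).
  by evaluate (ik, v1, s1).
have ev2 : eval w mu (satisfied snd_var snd_sign) = (mu propagated g.2.1 == g.2.2.+1).
  by evaluate (ik, v2, s2).
have ev3 : eval w mu (EGet propagated (cell_at fst_var idx)) = mu propagated g.1.1.
  by evaluate (ik, v1).
have ev4 : eval w mu (EGet propagated (cell_at snd_var idx)) = mu propagated g.2.1.
  by evaluate (ik, v2).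
have ev5 : eval w mu (EEq (cell_at fst_sign idx) (cell_at snd_sign idx)) =
    (g.1.2 == g.2.2).
  by evaluate (ik, s1, s2); case: (g.1.2); case: (g.2.2); rewrite // modn_small.
have skip : (forall a : assignment n, agree r a -> agree (mu propagated) a -> pair_val a g) ->
    leaf_inv r T0 p d k.+1 (update mu idx 0 k.+1).
  move=> sat; rewrite /leaf_inv /update /=; split=> //; exists ls; split=> //.
  - by split=> //; lia.
  - by case: tp => tp ns; split=> //; lia.
  - by rewrite tk; apply: scan_skip.
rewrite /scan_clause; case: (mu propagated g.1.1 =P g.1.2.+1) ev1 => [t1|u1] ev1.
  rewrite sem_true ?ev1 //; apply: skip => a _ Ra.
  by rewrite /pair_val (agree_eq Ra t1).
rewrite sem_false //; case: (mu propagated g.2.1 =P g.2.2.+1) ev2 => [t2|u2] ev2.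
  rewrite sem_true ?ev2 //; apply: skip => a _ Ra.
  by rewrite /pair_val (agree_eq Ra t2) orbT.
rewrite sem_false //; case: (mu propagated g.1.1 =P 0) ev3 => [z1|n1] ev3; last first.
  rewrite sem_true ?ev3 //; apply: (emit_literal_correct inv Gk) v2 s2 g2G _ u2; first by right.
  by move=> a _ Ra; rewrite /pair_val (agree_neq Ra n1 u1).
rewrite sem_false ?ev3 //; case: (mu propagated g.2.1 =P 0) ev4 => [z2|n2] ev4; last first.
  rewrite sem_true ?ev4 //; apply: (emit_literal_correct inv Gk) v1 s1 g1G _ u1; first by left.
  by move=> a _ Ra; rewrite /pair_val (agree_neq Ra n2 u2) orbF.
rewrite sem_false ?ev4 //.
(* The propagated assignment extends [r], so both variables are free in [r] as well and covering
   applies. *)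
have same_var : g.1.1 = g.2.1.
  by apply: cov => //; apply/eqP/negPn/negP => /eqP rn; have := ext _ rn; rewrite ?z1 ?z2 => e;
    case: rn; rewrite -e.
case: (g.1.2 =P g.2.2) ev5 => [same | differ] ev5.
  rewrite sem_true ?ev5 //; apply: (emit_literal_correct inv Gk) v1 s1 g1G _ u1; first by left.
  by move=> a _ Ra; rewrite /pair_val /literal_val -same_var -same orbb.
rewrite sem_false ?ev5 //; apply: skip => a _ _.
rewrite /pair_val /literal_val -same_var.
by case: (a _) (g.1.2) (g.2.2) differ => [] [] [].
Qed.

Lemma scan_correct mu :
  formula_arrays G mu -> (forall i, i < p -> mu tree i = T0 i) ->
  mu nlits 0 = 0 -> mu tree_pos 0 = p -> mu nset 0 = d -> mu consistent 0 = 1 ->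
  scan_state r [::] [::] (mu propagated) 1 d ->
  runs w scan mu (200 * (size G).+1) (leaf_inv r T0 p d (size G)).
Proof.
move=> FA pre nl tp ns c1 sc; have W1 : 1 < 2 ^ w by lia.
apply: (@runs_for _ (size G) 180 (leaf_inv r T0 p d)) => //; first lia.
- rewrite /leaf_inv /update /=; split=> //; exists [::]; rewrite take0 c1 ns nl tp addn0.
  by split=> //; split=> //; rewrite ?muln0 ?addn0.
- by move=> k mu1 [[ik lek] [_ mm _] _ _]; split; rewrite //= modn_small ?mm.
- move=> k mu1 ltk inv; have [[ik _] _ _ _] := inv.
  apply: runs_sem; [by []|by []|]; split; last exact: scan_clause_correct.
  by rewrite sem_writes.
- by rewrite /=; lia.
Qed.

End Leaf.

Lemma reset_correct n (G : seq (pair_clause n)) w mu :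
  16 * (n + size G).+1 <= 2 ^ w -> formula_arrays G mu ->
  (forall x, x \notin pair_vars G -> mu propagated x = mu branch x) ->
  runs w reset mu (80 * (size G).+1) (fun mu' =>
    frame [:: propagated; idx] mu mu' /\ mu' propagated =1 mu branch).
Proof.
move=> Hw FA out; have W1 : 1 < 2 ^ w by lia.
pose I k (mu1 : memory) := [/\ mu1 idx 0 = k /\ k <= size G,
  frame [:: propagated; idx] mu mu1 &
  forall x, (x \notin pair_vars G) || (x \in pair_vars (take k G)) ->
    mu1 propagated x = mu branch x].
apply: (@runs_for _ (size G) 60 I) => //; try lia.
- rewrite /I /update /=; split=> //.
    by move=> a i; rewrite !inE negb_or => /andP[_ /negPf->].
  by move=> x; rewrite take0 orbF => /out.
- move=> k mu1 [[-> le] fr _]; have [_ mm _] := formula_arrays_frame fr isT FA.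
  by split; rewrite //= modn_small ?mm.
- move=> k mu1 ltk [[ik lek] fr R1].
  have FA1 := formula_arrays_frame fr isT FA.
  have [g Gk] := onth_size ltk; have [_ _ /(_ _ _ Gk)[v1 _ v2 _]] := FA1.
  apply: runs_sem; [by []|by []|]; split; first by rewrite sem_writes.
  have br x : mu1 branch x = mu branch x by rewrite fr.
  rewrite /reset_clause.
  assign (val g.1.1) (mu branch g.1.1) (ik, v1, br).
  assign (val g.2.1) (mu branch g.2.1) (ik, v2, br).
  rewrite /= /I /update /=; split=> //.
    by move=> a i; rewrite !inE negb_or => /andP[n1 n2]; rewrite (negPf n1) (negPf n2) fr // !inE negb_or n1.
  move=> x; rewrite (onth_take_rcons Gk) /pair_vars !map_rcons [in X in _ || X]mem_cat !mem_rcons !inE => x0.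
  case: eqP => [-> //|/eqP ne2]; case: eqP => [-> //|/eqP ne1]; apply: R1.
  by move: x0; rewrite /pair_vars !mem_cat (negPf ne1) (negPf ne2).
- by move=> mu1 [_ fr R1]; split=> // x; apply: R1; rewrite take_size orNb.
- by rewrite /=; lia.
Qed.

Lemma leaf_correct n (G : seq (pair_clause n)) w (xs : seq 'I_n) mu p V :
  16 * (n + 3 * size G).+1 <= 2 ^ w -> p + 2 + 2 * size G < 2 ^ w ->
  formula_arrays G mu -> matched_vars G xs mu -> all (covers xs) G ->
  size xs <= 2 * size G -> mu tree_pos 0 = p ->
  (forall x, x \notin pair_vars G -> mu propagated x = 0) ->
  2 ^ size xs * #|[set a : assignment n | agree (mu branch) a]| = 2 ^ n ->
  counter n (3 * size G) (mu bits) V ->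
  V + #|[set a | agree (mu branch) a && all (pair_val a) G]| <= 2 ^ n ->
  runs w leaf mu (500 * (size G).+1) (fun mu' => exists ls : seq (literal n),
    [/\ size ls <= size G /\
         (forall a, agree (mu branch) a -> all (literal_val a) ls = all (pair_val a) G),
        mu' tree_pos 0 = p + size (encode_dtree (DLeaf ls)) /\
          (forall i, i < size (encode_dtree (DLeaf ls)) ->
             mu' tree (p + i) = nth 0 (encode_dtree (DLeaf ls)) i),
        forall i, i < p -> mu' tree i = mu tree i,
        counter n (3 * size G) (mu' bits)
          (V + #|[set a | agree (mu branch) a && all (pair_val a) G]|) &
        forall x, x \notin pair_vars G -> mu' propagated x = 0]).
Proof.
move=> Hw Hp FA [nm _ brE br0] cov szx tp pr0 cnt ctr leV.
have W1 : 1 < 2 ^ w by lia.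
apply: (@runs_seq _ _ _ _ (80 * (size G).+1) (420 * (size G).+1)); last by lia.
have r0 : runs w reset mu (80 * (size G).+1) _ := reset_correct _ FA _.
apply: runs_weaken (r0 _ _) (leqnn _) _; [by lia | by move=> x nx; rewrite pr0 ?br0 |].
move=> mu1 [fr1 pr1]; have FA1 := formula_arrays_frame fr1 isT FA.
apply: (@runs_seq _ _ _ _ 60 (360 * (size G).+1)); last by lia.
apply: runs_sem; [by []|by []|].
assign p 0 (tp, fr1).
have tp1 : mu1 tree_pos 0 = p by rewrite fr1.
have nm1 : mu1 nmatched 0 = size xs by rewrite fr1.
assign 0 p.+1 tp1.
assign 0 (p + 2) tp1.
assign 0 0 tp1.
assign 0 1 tp1.
assign 0 (size xs) nm1.
rewrite [sem _ _ _]/=; set mu2 := update _ nset _ _.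
have fr2 : frame [:: tree; propagated; idx; tree_pos; len_pos; consistent; nset; nlits] mu mu2.
  move=> a i; rewrite !inE !negb_or => /and5P[n1 n2 n3 n4 /and4P[n5 n6 n7 n8]].
  rewrite /mu2 /update (negPf n1) (negPf n4) (negPf n5) (negPf n6) (negPf n7) (negPf n8) /=.
  by rewrite fr1 // !inE negb_or n2.
have sc0 : scan_state G (mu branch) [::] [::] (mu2 propagated) 1 (size xs).
  have eqR (a : assignment n) : agree (mu2 propagated) a = agree (mu branch) a.
    by apply: eq_forallb => x; rewrite [mu2 _ _]pr1.
  split=> //.
  - by move=> a; rewrite eqR => ->.
  - by move=> x _; apply: pr1.
  - by move=> x nx; rewrite [mu2 _ _]pr1 br0.
  - by rewrite -cnt; congr (_ * _); apply: eq_card => a; rewrite !inE eqR.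
have scan_runs := @scan_correct n G w (p + 2) (size xs) (mu branch) (mu2 tree) _ _ _ mu2
  (formula_arrays_frame fr2 isT FA) (fun _ _ => erefl) erefl erefl erefl erefl sc0.
apply: (@runs_seq _ _ _ _ (200 * (size G).+1) (100 * (size G).+1)); last by lia.
apply: runs_weaken (runs_frame
  (S := [:: tree; propagated; tree_pos; consistent; nset; nlits; idx]) _ (scan_runs _ _ _)) _ _ => //.
- by lia.
- move=> g /(allP cov) /or3P[|| /eqP //]; rewrite -brE => /eqP nz z; by rewrite ?z in nz.
move=> mu3 [fr3 [_ FA3 pre3 [ls [[szl c1] nl3 [tp3 ns3] em sc]]]].
have lp3 : mu3 len_pos 0 = p.+1 by rewrite fr3.
apply: (@runs_seq _ _ _ _ 6 (90 * (size G).+1)); last by lia.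
apply: runs_sem; [by []|by []|].
rewrite (_ : sem _ _ _ = update mu3 tree p.+1 (size ls)); last first.
  by rewrite /= mod0n lp3 nl3.
set mu4 := update _ _ _ _.
rewrite take_size in sc; have [A B ext vars cntR] := sc.
have fin mu5 : frame [:: bits; bit_pos] mu4 mu5 ->
    counter n (3 * size G) (mu5 bits)
      (V + #|[set a | agree (mu branch) a && all (pair_val a) G]|) ->
    exists ls : seq (literal n),
    [/\ size ls <= size G /\
         (forall a, agree (mu branch) a -> all (literal_val a) ls = all (pair_val a) G),
        mu5 tree_pos 0 = p + size (encode_dtree (DLeaf ls)) /\
          (forall i, i < size (encode_dtree (DLeaf ls)) ->
             mu5 tree (p + i) = nth 0 (encode_dtree (DLeaf ls)) i),
        forall i, i < p -> mu5 tree i = mu tree i,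
        counter n (3 * size G) (mu5 bits)
          (V + #|[set a | agree (mu branch) a && all (pair_val a) G]|) &
        forall x, x \notin pair_vars G -> mu5 propagated x = 0].
  move=> fr5 ctr5; exists ls; split=> //.
  - rewrite [encode_dtree _]/= /= size_encode_literal; split.
      by rewrite fr5 // [mu4 _ _]tp3; lia.
    move=> i lti; rewrite fr5 // /mu4 /update /=.
    case: i lti => [|[|i]] lti.
    + by rewrite addn0 ltn_eqF // pre3 ?/mu2 /update /= ?eqxx //; lia.
    + by rewrite addn1 eqxx.
    + have lti' : i < 2 * size ls by [].
      by rewrite gtn_eqF; [apply: etrans (em i lti'); congr (mu3 _ _); lia | lia].
  - move=> i lti; rewrite fr5 // /mu4 /update /= ltn_eqF ?(ltnW lti) //; last by lia.
    by rewrite pre3 ?/mu2 /update /= ?ltn_eqF ?fr1 //; lia.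
  - by move=> x nx; rewrite fr5 //; apply: vars.
have nz : 0 < 2 ^ n by rewrite expn_gt0.
(* The cofactor of [2 ^ q] in [2 ^ n] is nonzero. *)
have qn : mu3 nset 0 <= n.
  rewrite -(leq_exp2l _ _ (isT : 1 < 2)) -cntR leq_pmulr //.
  by move: nz; rewrite -cntR muln_gt0 => /andP[].
pose Q (mu5 : memory) := counter n (3 * size G) (mu5 bits)
  (V + #|[set a | agree (mu branch) a && all (pair_val a) G]|).
have R : runs w (CIf (var consistent) add_bit CSkip) mu4 (90 * (size G).+1) Q.
  have ctr4 : counter n (3 * size G) (mu4 bits) V.
    by apply: counter_ext ctr => i; rewrite /mu4 /update /= fr3 // fr2.
  have ev : eval w mu4 (var consistent) = mu3 consistent 0 by rewrite /= mod0n.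
  have RA (a : assignment n) : agree (mu3 propagated) a -> agree (mu branch) a.
    move=> /forallP Ra; apply/forallP => x; have := Ra x.
    by have [-> // | rn] := eqVneq (mu branch x) 0; rewrite ext ?(negPf rn) //; apply/eqP.
  apply: (runs_weaken (runs_if (T := 30 * (3 * size G).+1) (Q := Q) _ _)).
  - rewrite ev => ok.
    have E : #|[set a | agree (mu branch) a && all (pair_val a) G]| = 2 ^ (n - mu3 nset 0).
      apply/eqP; rewrite -(eqn_pmul2l (m := 2 ^ mu3 nset 0)) ?expn_gt0 //.
      rewrite -expnD subnKC // -cntR; apply/eqP; congr (_ * _); apply: eq_card => a; rewrite !inE.
      case ra: (agree (mu branch) a); first by rewrite /= -(A a ra) (B a ra) ok.
      by case Ra: (agree _ a) => //; rewrite RA in ra.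
    (* The number of assigned variables is at most [size xs + size G], hence at most [3 * size G],
       as the counter demands. *)
    rewrite /Q E in leV *; apply: (@add_bit_correct n _ w mu4 V (mu3 nset 0)) => //; try lia.
    by rewrite /mu4 /update /= fr3 // fr2 //; case: FA.
  - rewrite ev => ok; have E : #|[set a | agree (mu branch) a && all (pair_val a) G]| = 0.
      apply: eq_card0 => a; rewrite !inE.
      by case ra: (agree (mu branch) a); rewrite //= -(A a ra) (B a ra) ok.
    by apply: runs_sem; [by []|by rewrite muln_gt0|rewrite /Q E addn0].
  - by rewrite /=; lia.
  - by [].
apply: runs_weaken (runs_frame (S := [:: bits; bit_pos]) _ R) _ _ => //.
by move=> mu5 [fr5 ctr5]; apply: fin.
Qed.

(** * Branching *)

(** The level is a constant of the program text, and levels beyond the number of matched variables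
    are skipped at run time. Output follows the preorder of [encode_dtree], false before true; the
    stored values 1 and 2 are these booleans plus one. *)
Fixpoint branch_tree (j : nat) : cmd :=
  if j is i.+1 then
    CIf (ELt (num i) (var nmatched))
      (CSeq (block [:: CSet tree (var tree_pos) (num 1);
                       CSet tree (EAdd (var tree_pos) (num 1)) (EGet matched (num i));
                       set_var tree_pos (EAdd (var tree_pos) (num 2));
                       CSet branch (EGet matched (num i)) (num 1)])
      (CSeq (branch_tree i)
      (CSeq (CSet branch (EGet matched (num i)) (num 2))
        (branch_tree i))))
      (branch_tree i)
  else leaf.

Definition tree_arrays : seq nat := [:: 2; 3; 8; 10; 12; 16; 17; 18; 19; 20; 22].

Lemma branch_tree_writes j : all (mem tree_arrays) (writes (branch_tree j)).
Proof. by elim: j => // j IH; rewrite /= !all_cat /= !IH. Qed.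

Section BranchTree.

Variables (n : nat) (G : seq (pair_clause n)) (w : nat) (xs : seq 'I_n).
Hypothesis Hw : 16 * (n + 3 * size G).+1 <= 2 ^ w.
Hypothesis Uxs : uniq xs.
Hypothesis szx : size xs <= 2 * size G.
Hypothesis cov : all (covers xs) G.

Definition models (r : nat -> nat) : nat :=
  #|[set a : assignment n | agree r a && all (pair_val a) G]|.

Definition assign_var (r : nat -> nat) (x : 'I_n) (b : bool) : nat -> nat :=
  fun y => if y == x then b.+1 else r y.

Lemma models_split (r : nat -> nat) (x : 'I_n) :
  r x = 0 -> models r = models (assign_var r x false) + models (assign_var r x true).
Proof.
move=> r0.
have E b a : agree (assign_var r x b) a = agree r a && (a x == b).
  exact: (@agree_set n r _ (x, b) a r0 (fun y => erefl)).
rewrite /models -(cardsID [set a : assignment n | a x == false]).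
congr (_ + _); apply: eq_card => a; rewrite !inE E.
  by rewrite andbAC.
by case: (a x); case: (agree r a); case: (all _ G).
Qed.

(** [r] is [branch] with the first [j] matched variables freed: their cells hold leftovers of the
    matching or of earlier subtrees, overwritten before any leaf is reached. *)
Definition tree_state (j p V : nat) (r : nat -> nat) (mu : memory) : Prop :=
  [/\ matched_vars G xs mu, formula_arrays G mu /\ mu tree_pos 0 = p,
      forall x, x \notin pair_vars G -> mu propagated x = 0,
      forall x : 'I_n, r x = (if x \in take j xs then 0 else mu branch x) &
      counter n (3 * size G) (mu bits) V].

(** The bounds are closed under the recursion: strictness in the bound on [dtree_size] absorbs the
    inner node, and the slack 2 its two header cells. *)
Definition tree_emitted (j p V : nat) (r : nat -> nat) (mu mu' : memory) (T : dtree n) : Prop :=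
  [/\ (forall a, agree r a -> dtree_val a T = all (pair_val a) G) /\ dtree_size T < 2 ^ j.+1,
      size (encode_dtree T) + 2 <= 2 ^ j * (2 * size G + 4),
      (forall i, i < size (encode_dtree T) -> mu' tree (p + i) = nth 0 (encode_dtree T) i) /\
      (forall i, i < p -> mu' tree i = mu tree i),
      forall x : 'I_n, x \notin take j xs -> mu' branch x = mu branch x &
      tree_state j (p + size (encode_dtree T)) (V + models r) r mu'].

(** The power of 2 in the counting hypothesis says that [r] fixes exactly the matched variables from
    index [j] on. The subtracted 40 pays for the work at an inner node. *)
Lemma branch_tree_correct j p V r mu :
  tree_state j p V r mu -> p + 2 ^ j * (2 * size G + 4) < 2 ^ w ->
  2 ^ (size xs - j) * #|[set a : assignment n | agree r a]| = 2 ^ n ->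
  V + models r <= 2 ^ n ->
  runs w (branch_tree j) mu (2 ^ j * (540 * (size G).+1) - 40)
    (fun mu' => exists T, tree_emitted j p V r mu mu' T).
Proof.
have W1 : 1 < 2 ^ w by lia.
elim: j p V r mu => [|j IH] p V r mu [MV [FA tp] pr rE ctr] Hp cnt leV.
  have rB (a : assignment n) : agree r a = agree (mu branch) a.
    by apply: eq_forallb => x; rewrite rE take0.
  have mB : models r = #|[set a | agree (mu branch) a && all (pair_val a) G]|.
    by apply: eq_card => a; rewrite !inE rB.
  rewrite expn0 mul1n in Hp *.
  have Hp' : p + 2 + 2 * size G < 2 ^ w by lia.
  have cnt' : 2 ^ size xs * #|[set a : assignment n | agree (mu branch) a]| = 2 ^ n.
    by rewrite -cnt subn0; congr (_ * _); apply: eq_card => a; rewrite !inE rB.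
  rewrite mB in leV; have L := leaf_correct Hw Hp' FA MV cov szx tp pr cnt' ctr leV.
  apply: runs_weaken (runs_frame (S := [:: 2; 3; 10; 12; 16; 17; 18; 19; 20; 22]) _ L) _ _ => //.
    by lia.
  move=> mu' [fr [ls [[szl lsE] [tp' em] pre ctr' pr']]].
  exists (DLeaf ls); split=> //.
  - by split=> // a; rewrite rB; apply: lsE.
  - by rewrite [encode_dtree _]/= /= size_encode_literal; lia.
  - by move=> x _; rewrite fr.
  - split=> //; last by rewrite mB.
    + by case: MV => ? mt bE b0; split=> [|k x /mt|x|x /b0]; rewrite fr.
    + by split=> //; apply: formula_arrays_frame fr isT FA.
    + by move=> x; rewrite take0 fr // rE take0.
have pow : 2 ^ j.+1 * (2 * size G + 4) = 2 * (2 ^ j * (2 * size G + 4)).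
  by rewrite expnS -mulnA.
have powT : 2 ^ j.+1 * (540 * (size G).+1) = 2 * (2 ^ j * (540 * (size G).+1)).
  by rewrite expnS -mulnA.
have ge1 : 540 <= 2 ^ j * (540 * (size G).+1).
  by rewrite mulnCA leq_pmulr // muln_gt0 expn_gt0.
have jw : j < 2 ^ w.
  apply: leq_trans (ltnW Hp); apply: leq_trans (leq_addl _ _).
  rewrite pow mulnCA; apply: leq_trans (ltn_expl j (isT : 1 < 2)) _.
  by rewrite leq_pmulr //; lia.
have [nm mt brE br0] := MV; have [mn mm _] := FA.
apply: (runs_weaken (T := 5 + (2 * (2 ^ j * (540 * (size G).+1)) - 45))
  (Q := fun mu' => exists T, tree_emitted j.+1 p V r mu mu' T)) => //; last by lia.
have ev : eval w mu (ELt (num j) (var nmatched)) = (j < size xs).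
  by rewrite /= mod0n nm modn_bool // modn_small.
apply: (runs_if (e := ELt (num j) (var nmatched))) => [|]; rewrite ev; last first.
  move=> js; have {js} le_s : size xs <= j by case: ltnP js.
  have tk : take j.+1 xs = take j xs by rewrite !take_oversize // ltnW.
  apply: runs_weaken (IH p V r mu _ _ _ _) _ _ => //.
  - by split=> // x; rewrite rE tk.
  - by lia.
  - have [z1 z0] : size xs - j.+1 = 0 /\ size xs - j = 0.
      by split; apply/eqP; rewrite subn_eq0 // ltnW.
    by rewrite z1 in cnt; rewrite z0.
  - by lia.
  - move=> mu' [T [[TE szT] szE em br [MV' FA' pr' rE' ctr']]]; exists T; split=> //.
    + by split=> //; rewrite expnS; lia.
    + by lia.
    + by rewrite tk.
    + by split=> // x; rewrite tk.
move=> js; have {js} lt_s : j < size xs by case: ltnP js.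
have [x xj] := onth_size lt_s.
have tk := onth_take_rcons xj; have mx := mt _ _ xj.
have xs_x : x \in xs by apply/onthP; exists j.
have xnt : x \notin take j xs.
  by have := take_uniq j.+1 Uxs; rewrite tk rcons_uniq => /andP[].
have rx : r x = 0 by rewrite rE tk mem_rcons inE eqxx.
have pvx : val x \in pair_vars G.
  by apply: contraTT xs_x => /br0 b0; rewrite -brE b0.
have cnt_x b : 2 ^ (size xs - j) * #|[set a : assignment n | agree (assign_var r x b) a]| = 2 ^ n.
  have := @card_agree_set n r (assign_var r x b) (x, b) rx (fun y => erefl).
  by rewrite -cnt => <-; rewrite (_ : size xs - j = (size xs - j.+1).+1) ?expnSr ?mulnA //; lia.
rewrite (models_split rx) in leV *.
set V0 := models _ in leV *; set V1 := models _ in leV *.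
apply: (@runs_seq _ _ _ _ 24 (2 * (2 ^ j * (540 * (size G).+1)) - 70)); last by lia.
apply: runs_sem; [by []|by []|].
assign p 1 tp.
assign p.+1 (val x) (tp, mx).
assign 0 (p + 2) tp.
assign (val x) 1 mx.
rewrite [sem _ _ _]/=; set mu1 := update _ branch _ _.
have mu1b y : mu1 branch y = if y == x :> nat then 1 else mu branch y by [].
have mu1f : frame [:: tree; tree_pos; branch] mu mu1.
  by move=> a i; rewrite !inE !negb_or /mu1 /update => /and3P[/negPf-> /negPf-> /negPf->].
apply: (@runs_seq _ _ _ _ (2 ^ j * (540 * (size G).+1) - 40)
  (2 ^ j * (540 * (size G).+1) - 30)); last by lia.
have state1 : tree_state j (p + 2) V (assign_var r x false) mu1.
  split=> //.
  - split=> [||y|y yn]; rewrite ?mu1b ?mu1f //.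
      by case: (val y =P val x) => [/val_inj->|_]; rewrite ?xs_x ?brE.
    by case: eqP => [yx|_]; [rewrite yx pvx in yn | apply: br0].
  - move=> y; rewrite /assign_var mu1b; case: eqP => [/val_inj->|/eqP yx].
      by rewrite (negPf xnt).
    by rewrite rE tk mem_rcons inE -val_eqE (negPf yx).
apply: runs_weaken (runs_frame (S := tree_arrays) (branch_tree_writes j)
  (IH _ _ _ _ state1 _ (cnt_x false) _)) (leqnn _) _; [by lia|by rewrite -/V0; lia|].
move=> mu2 [fr2 [T0 [[T0E sz0] szE0 [em0 pre0] br2 [MV2 [FA2 tp2] pr2 rE2 ctr2]]]].
rewrite -/V0 in ctr2.
have [nm2 mt2 brE2 br02] := MV2; have mx2 := mt2 _ _ xj.
apply: (@runs_seq _ _ _ _ 5 (2 ^ j * (540 * (size G).+1) - 40)); last by lia.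
apply: runs_sem; [by []|by []|].
rewrite (_ : sem _ _ _ = update mu2 branch x 2); last first.
  by rewrite /= (modn_small jw) mx2 modn_small //; lia.
set mu3 := update _ _ _ _.
have mu3b y : mu3 branch y = if y == x :> nat then 2 else mu2 branch y by [].
have mu3f : frame [:: branch] mu2 mu3.
  by move=> a i; rewrite !inE /mu3 /update => /negPf->.
set p0 := p + 2 + _ in tp2.
(* The first subtree changed [branch] only at the first [j] matched variables, so rewriting the cell
   of [x] is enough to switch sides. *)
have state3 : tree_state j p0 (V + V0) (assign_var r x true) mu3.
  split=> //.
  - split=> [||y|y yn]; rewrite ?mu3b ?mu3f //.
      by case: (val y =P val x) => [/val_inj->|_]; rewrite ?xs_x ?brE2.
    by case: eqP => [yx|_]; [rewrite yx pvx in yn | apply: br02].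
  - move=> y; rewrite /assign_var mu3b; case: eqP => [/val_inj->|/eqP yx].
      by rewrite (negPf xnt).
    rewrite rE tk mem_rcons inE -val_eqE (negPf yx) /=; case: ifP => // /negbT ynt.
    by rewrite br2 // mu1b (negPf yx).
apply: runs_weaken (IH _ _ _ _ state3 _ (cnt_x true) _) (leqnn _) _; [by lia|by rewrite -/V1; lia|].
move=> mu4 [T1 [[T1E sz1] szE1 [em1 pre1] br4 [MV4 [FA4 tp4] pr4 rE4 ctr4]]].
rewrite -/V1 in ctr4.
exists (DNode x T0 T1); split.
- split; last by rewrite /= !expnS in sz0 sz1 *; lia.
  move=> a ra /=; have agx b : a x == b -> agree (assign_var r x b) a.
    by move=> ax; rewrite (@agree_set n r _ (x, b) a rx (fun y => erefl)) ra.
  by case ax: (a x); [apply: T1E | apply: T0E]; apply: agx; rewrite ax.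
- by rewrite /= size_cat; lia.
- split=> [i|i lti]; last first.
    by rewrite pre1 ?[mu3 _ _]pre0 /mu1 /update /= ?ltn_eqF //; lia.
  case: i => [|[|i]] /= lti.
  + by rewrite addn0 pre1 ?[mu3 _ _]pre0 /mu1 /update /= ?eqxx ?ltn_eqF //; lia.
  + by rewrite addn1 pre1 ?[mu3 _ _]pre0 /mu1 /update /= ?eqxx //; lia.
  + rewrite nth_cat; case: ltnP => lt0.
      rewrite pre1; last by lia.
      by rewrite -em0 // mu3f //; congr (mu2 _ _); lia.
    by rewrite -em1; [congr (mu4 _ _); lia | rewrite size_cat in lti; lia].
- move=> y; rewrite tk mem_rcons inE negb_or => /andP[yx ynt].
  by rewrite br4 // mu3b val_eqE (negPf yx) br2 // mu1b val_eqE (negPf yx).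
- rewrite (models_split rx) -/V0 -/V1 addnA.
  have -> : p + size (encode_dtree (DNode x T0 T1)) = p0 + size (encode_dtree T1).
    by rewrite /= size_cat; lia.
  split=> // y; rewrite tk mem_rcons inE.
  have := rE4 y; rewrite /assign_var; have [-> _ | yx] := eqVneq y x; first by rewrite rx.
  by rewrite val_eqE (negPf yx).
Qed.

End BranchTree.

(** * Comparison with the threshold *)

(* After [k] bits of the count, with value [h], the deficit is
   [minn B (a * 2 ^ k - B * h)] for [B = 2 * b]: it stays at 0 once the
   threshold is reached and at [B] once it is out of reach.  The factor 2 in [B]
   makes up for the count having n + 1 bits. *)
Definition compare_bit (B : nat) : cmd :=
  CSeq (CIf (EGet bits (ESub nvars (var idx)))
      (block [:: set_var deficit (ESub (EAdd (var deficit) (var deficit)) (num B))])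
      (block [:: set_var deficit (EAdd (var deficit) (var deficit))]))
    (CIf (ELt (num B) (var deficit)) (block [:: set_var deficit (num B)]) CSkip).

(** This is [1 + minn n (3 * m)] for [m] clauses: two truncated subtractions express the minimum. *)
Definition top_bits_bound : expr :=
  EAdd (num 1) (ESub nvars (ESub nvars (EAdd (EAdd nclauses nclauses) nclauses))).

Definition compare (a b : nat) : cmd :=
  CSeq (set_var deficit (num a))
  (CSeq (for_loop idx top_bits_bound (compare_bit (2 * b)))
    (CSet answer (num 0) (ELt (var deficit) (num 1)))).

Lemma compare_correct n m w a b V mu :
  a < b -> 16 * (n + 3 * m).+1 <= 2 ^ w -> 4 * b < 2 ^ w ->
  mu 0 0 = n -> mu 0 1 = m -> counter n (3 * m) (mu bits) V ->
  runs w (compare a b) mu (200 * m.+1) (fun mu' =>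
    frame [:: answer; idx; deficit] mu mu' /\ mu' answer 0 = (a * 2 ^ n <= b * V)).
Proof.
move=> ab Hw Hb mn mm [c1 cV c0]; have W1 : 1 < 2 ^ w by lia.
pose B := 2 * b; pose N := (minn n (3 * m)).+1.
have leN : N <= n.+1 by rewrite ltnS geq_minl.
have leN3 : N <= (3 * m).+1 by rewrite ltnS geq_minr.
pose I k (mu1 : memory) := [/\ mu1 idx 0 = k /\ k <= N, frame [:: idx; deficit] mu mu1 &
  mu1 deficit 0 = minn B (a * 2 ^ k - B * top_bits n (mu bits) k)].
apply: (@runs_seq _ _ _ _ 3 (190 * m.+1)); last by lia.
apply: runs_sem; [by []|by []|].
rewrite (_ : sem _ _ _ = update mu deficit 0 a); last first.
  by rewrite /= mod0n modn_small //; lia.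
apply: (@runs_seq _ _ _ _ (180 * m.+1) 6); last by lia.
apply: (@runs_for _ N 30 I) => //; try lia.
- rewrite /I /update /= expn0 muln0 subn0; split=> //; last by rewrite /B; lia.
  by move=> c i; rewrite !inE negb_or => /andP[/negPf-> /negPf->].
- move=> k mu1 [[-> le] fr _]; split=> //.
  have [n1 m1] : mu1 0 0 = n /\ mu1 0 1 = m by rewrite !fr.
  by rewrite /top_bits_bound; evaluate (n1, m1); rewrite /N /minn; case: ltnP; lia.
- move=> k mu1 ltk [[ik lek] fr dE].
  have n1 : mu1 0 0 = n by rewrite fr.
  have bE : mu1 bits (n - k) = mu bits (n - k) by rewrite fr.
  apply: runs_sem; [by []|by []|]; split; first by rewrite sem_writes.
  set P := a * 2 ^ k in dE; set h := top_bits n (mu bits) k in dE.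
  pose D := if mu bits (n - k) == 0 then 2 * minn B (P - B * h) else 2 * minn B (P - B * h) - B.
  (* The deficit is capped at [2 * b], so doubling it does not wrap around. *)
  have D4 : 2 * minn B (P - B * h) < 2 ^ w.
    by apply: leq_ltn_trans Hb; rewrite (_ : 4 * b = 2 * B) ?leq_mul2l ?geq_minl // /B; lia.
  have DB : B < 2 ^ w by rewrite /B; lia.
  rewrite /compare_bit sem_seq.
  have -> : sem w (CIf (EGet bits (ESub nvars (var idx)))
      (block [:: set_var deficit (ESub (EAdd (var deficit) (var deficit)) (num B))])
      (block [:: set_var deficit (EAdd (var deficit) (var deficit))])) mu1 =
      update mu1 deficit 0 D.
    have ev : eval w mu1 (EGet bits (ESub nvars (var idx))) = mu bits (n - k).
      by rewrite /= mod0n ik n1 bE.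
    rewrite /D; case: eqP ev => [-> | c_nz] ev.
      by rewrite sem_false // -[RHS]/(sem w (block [::]) _);
        apply: sem_assign; rewrite /= mod0n // dE addnn -mul2n modn_small.
    rewrite sem_true ?ev // -[RHS]/(sem w (block [::]) _).
    by apply: sem_assign; rewrite /= mod0n // dE addnn -mul2n !modn_small.
  have -> : sem w (CIf (ELt (num B) (var deficit)) (block [:: set_var deficit (num B)]) CSkip)
      (update mu1 deficit 0 D) =
      if B < D then update (update mu1 deficit 0 D) deficit 0 B else update mu1 deficit 0 D.
    have ev : eval w (update mu1 deficit 0 D) (ELt (num B) (var deficit)) = (B < D).
      by rewrite /= mod0n modn_bool // modn_small.
    case: ifP ev => BD ev; last by rewrite sem_false.
    by rewrite sem_true ?ev // -[RHS]/(sem w (block [::]) _); apply: sem_assign; rewrite /= ?mod0n ?modn_small.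
  split; first by split=> //; case: ifP.
    move=> c i ci; have := ci; rewrite !inE negb_or => /andP[/negPf ci1 /negPf ci2].
    by case: ifP => _; rewrite /update ci1 ci2 /= fr.
  have -> : update (if B < D then update (update mu1 deficit 0 D) deficit 0 B
      else update mu1 deficit 0 D) idx 0 k.+1 deficit 0 = minn B D.
    by rewrite /minn /update /=; case: ifP.
  rewrite /= -/h expnS mulnCA -/P /D mulnDr mulnCA.
  move: (B * h) => Q; have := c1 (n - k).
  by case: (mu bits (n - k)) => [|[|]] //= _; rewrite ?muln0 ?muln1; lia.
- move=> mu1 [_ fr dE].
  apply: runs_sem; [by []|by []|].
  rewrite (_ : sem _ _ _ = update mu1 answer 0 (mu1 deficit 0 < 1)); last first.
    by rewrite /= mod0n modn_bool // modn_small.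
  split.
    move=> c i ci; have := ci; rewrite !inE !negb_or => /and3P[/negPf ca ci1 ci2].
    by rewrite /update ca /= fr // !inE negb_or ci1.
  rewrite /update /= dE; congr nat_of_bool.
  have topV : V = 2 ^ (n.+1 - N) * top_bits n (mu bits) N.
    rewrite -cV; apply: binval_top_bits => // i lti; apply: c0.
    by move: lti; rewrite /N; clear; lia.
  (* Both sides are doubled, then divided by the common factor [2 ^ (n.+1 - N)]. *)
  have rhs : (a * 2 ^ n <= b * V) = (a * 2 ^ N <= B * top_bits n (mu bits) N).
    rewrite -(leq_pmul2l (m := 2)) // mulnCA -[2 * 2 ^ n]expnS -(subnK leN) expnD topV.
    rewrite mulnCA [2 * (b * _)]mulnA [_ * (2 ^ _ * top_bits _ _ _)]mulnCA.
    by rewrite leq_pmul2l ?expn_gt0.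
  rewrite rhs -[in RHS]subn_eq0; move: (_ - _) => X; have B0 : 0 < B by rewrite /B; lia.
  by case: X => [|X]; rewrite ?minn0 // ltnNge leq_min B0.
- by rewrite /=; lia.
Qed.

(** * The algorithm *)

(** Both early exits leave the answer cell at its initial 0, which means rejection. *)
Definition count_models (a b L : nat) : cmd :=
  CSeq parse
  (CIf (var empty_seen) CSkip
    (CSeq match_clauses
      (CIf (ELt (var nmatched) (num (2 * L)))
        (CSeq (branch_tree (2 * L)) (compare a b))
        CSkip))).

Lemma nsat_empty_clause n (F : cnf n) : has (@nilp _) F -> nsat F = 0.
Proof.
move=> /hasP[c cF c0]; apply: eq_card0 => a; rewrite !inE.
by apply/negbTE/allPn; exists c => //; rewrite (nilP c0).
Qed.

(** The word-size factor has one summand per need: 64 for input offsets and counter positions,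
    [8 * 4 ^ L] for the output pointer, [4 * b] for the deficit. *)
Lemma count_models_correct a b L n (F : cnf n) w :
  0 < a < b -> b * 3 ^ L < a * 4 ^ L -> is_kcnf 2 F ->
  (64 + 8 * 4 ^ L + 4 * b) * (n + size F).+1 <= 2 ^ w ->
  runs w (count_models a b L) (input_memory F) (4 ^ L * (1000 * (size F).+1)) (fun mu =>
    outputs_answer mu (a * 2 ^ n <= b * nsat F) /\
    (a * 2 ^ n <= b * nsat F -> outputs_count n mu (nsat F) /\
       exists T : dtree n, [/\ represents T F, dtree_size T < 2 * 4 ^ L & outputs_dtree mu T])).
Proof.
move=> /andP[a0 ab] abL kF; set m := size F => Hw.
have L4 : 0 < 4 ^ L by rewrite expn_gt0.
have n2 : 0 < 2 ^ n by rewrite expn_gt0.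
have Hw1 : 64 * (n + m).+1 <= 2 ^ w by apply: leq_trans Hw; rewrite leq_mul2r; lia.
have Hw2 : 8 * 4 ^ L * m.+1 <= 2 ^ w by apply: leq_trans Hw; apply: leq_mul; lia.
have Hw3 : 4 * b < 2 ^ w by apply: leq_trans Hw; rewrite mulnS; lia.
have Hw4 : 8 * 4 ^ L < 2 ^ w by apply: leq_trans Hw; rewrite mulnS; lia.
have W1 : 1 < 2 ^ w by lia.
have cost1 : m.+1 <= 4 ^ L * m.+1 by rewrite leq_pmull.
have E1000 : 4 ^ L * (1000 * m.+1) = 1000 * (4 ^ L * m.+1) by rewrite mulnCA.
have E540 : 4 ^ L * (540 * m.+1) = 540 * (4 ^ L * m.+1) by rewrite mulnCA.
have ltL : L < 4 ^ L by apply: ltn_expl.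
have w2L : 2 * L < 2 ^ w by lia.
have neg (mu : memory) : mu answer 0 = 0 -> b * nsat F < a * 2 ^ n ->
    outputs_answer mu (a * 2 ^ n <= b * nsat F) /\
    (a * 2 ^ n <= b * nsat F -> outputs_count n mu (nsat F) /\
       exists T : dtree n, [/\ represents T F, dtree_size T < 2 * 4 ^ L & outputs_dtree mu T]).
  by move=> mu0; rewrite ltnNge => /negPf->.
apply: (@runs_seq _ _ _ _ (80 * m.+1) (900 * (4 ^ L * m.+1))); last by lia.
apply: runs_weaken (parse_correct kF _) (leqnn _) _; first by rewrite -/m; lia.
move=> mu1 [es FA1 fr1].
apply: (runs_weaken (T := 3 + (890 * (4 ^ L * m.+1))) (runs_if (e := var empty_seen) _ _)) => [|||mu']; last by apply.
- rewrite /= mod0n es => ne; apply: runs_sem; [by []|by rewrite /=; lia|].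
  by apply: neg; [rewrite /= fr1 | rewrite nsat_empty_clause; [lia | case: has ne]].
- rewrite /= mod0n es => noempty; have {}noempty : ~~ has (@nilp _) F by case: has noempty.
  set G := pmap (@pair_of n) F in FA1.
  have szG : size G = m by rewrite -[LHS](size_map Some) pairs_of_cnf // size_map.
  have Gval a' : all (pair_val a') G = cnf_val a' F by apply: pairs_val.
  have satG : #|[set a' | all (pair_val a') G]| = nsat F.
    by apply: eq_card => a'; rewrite !inE Gval.
  have z1 c i : c \notin [:: 0; 4; 5; 6; 7; 12; 13; 14] -> mu1 c i = 0.
    by rewrite inE negb_or => /andP[c0 nc]; rewrite fr1 // /input_memory (negPf c0).
  have FA := FA1 noempty.
  apply: (@runs_seq _ _ _ _ (80 * m.+1) (800 * (4 ^ L * m.+1))); last by lia.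
  rewrite -szG; apply: runs_weaken (match_clauses_correct (G := G) _ FA _ _) (leqnn _) _.
  + by rewrite szG; lia.
  + by move=> i; rewrite z1.
  + by rewrite z1.
  move=> mu2 [fr2 [xs [Uxs MV cov szx big]]].
  have [nm _ brE br0] := MV.
  have FA2 := formula_arrays_frame fr2 isT FA.
  have z2 c i : c \notin [:: 0; 4; 5; 6; 7; 8; 9; 12; 13; 14; 15] -> mu2 c i = 0.
    rewrite !inE !negb_or => /and5P[q0 q4 q5 q6 /and5P[q7 q8 q9 q12 /and3P[q13 q14 q15]]].
    rewrite fr2; last by rewrite !inE !negb_or q8 q9 q12.
    by apply: z1; rewrite !inE !negb_or q0 q4 q5 q6 q7 q12 q13.
  have ev : eval w mu2 (ELt (var nmatched) (num (2 * L))) = (size xs < 2 * L).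
    by rewrite /= mod0n nm modn_bool // modn_small.
  apply: (runs_weaken (T := 5 + (790 * (4 ^ L * m.+1)))
    (runs_if (e := ELt (var nmatched) (num (2 * L))) _ _)) => [|||mu']; last by apply.
  + rewrite ev => lt_s; have {}lt_s : size xs < 2 * L by case: ltnP lt_s.
    pose r := fun _ : nat => 0.
    have p4 : 2 ^ (2 * L) = 4 ^ L by rewrite expnM.
    have mr : models G r = nsat F.
      by rewrite -satG; apply: eq_card => a'; rewrite !inE agree0.
    (* Fewer than [2 * L] variables are matched, so at the root all of them are freed and [r] is
       empty. *)
    have st : tree_state G xs (2 * L) 0 0 r mu2.
      split=> //.
      * by split=> //; rewrite z2.
      * by move=> x _; rewrite z2.
      * move=> x; rewrite take_oversize; last exact: ltnW.
        by case: ifP => // nx; have := brE x; rewrite nx => /negbFE/eqP.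
      * split=> [i||i _]; rewrite ?z2 // /binval big1 // => i _.
        by rewrite z2.
    have Hp : 0 + 2 ^ (2 * L) * (2 * size G + 4) < 2 ^ w.
      rewrite add0n p4 szG; apply: leq_trans Hw2; rewrite [8 * _]mulnC -mulnA.
      by rewrite ltn_pmul2l //; lia.
    have cnt : 2 ^ (size xs - 2 * L) * #|[set a' : assignment n | agree r a']| = 2 ^ n.
      rewrite (_ : size xs - 2 * L = 0) ?mul1n; last by lia.
      by rewrite -card_assignment -cardsT; apply: eq_card => a'; rewrite !inE agree0.
    have le2 : 0 + models G r <= 2 ^ n.
      by rewrite add0n -card_assignment max_card.
    have Hw' : 16 * (n + 3 * size G).+1 <= 2 ^ w by rewrite szG; lia.
    have BT := branch_tree_correct Hw' Uxs szx cov st Hp cnt le2.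
    apply: (@runs_seq _ _ _ _ (540 * (4 ^ L * m.+1)) (200 * m.+1)); last by lia.
    apply: runs_weaken BT _ _; first by rewrite p4 szG; lia.
    move=> mu3 [T [[TE szT] szE [em _] _ [_ [[n3 m3 _] _] _ _ ctr]]].
    rewrite add0n mr in ctr.
    have m3' : mu3 0 1 = m by rewrite m3.
    rewrite szG in ctr Hw'.
    apply: runs_weaken (compare_correct ab Hw' Hw3 n3 m3' ctr) (leqnn _) _.
    move=> mu4 [fr4 ans]; split=> // _; have [c1 cV _] := ctr.
    split.
      split=> [i _|]; first by rewrite fr4.
      by rewrite -cV /binval; apply: eq_bigr => i _; rewrite fr4.
    exists T; split.
    * by move=> a'; rewrite TE ?Gval // agree0.
    * by move: szT; rewrite expnS p4.
    * by move=> i lti; rewrite fr4 //; apply: em.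
  + rewrite ev => ge_s; have {}ge_s : 2 * L <= size xs by case: ltnP ge_s.
    apply: runs_sem; [by []|by rewrite /=; lia|]; apply: neg; first by rewrite /= z2.
    (* [4 ^ L * (b * nsat F) <= b * 3 ^ L * 2 ^ n < a * 4 ^ L * 2 ^ n], by the choice of [L]. *)
    have := big L ge_s; rewrite satG => le; rewrite -(ltn_pmul2l L4).
    rewrite mulnCA; apply: leq_ltn_trans (leq_mul (leqnn b) le) _.
    by rewrite mulnA [4 ^ L * _]mulnA [4 ^ L * a]mulnC ltn_pmul2r.
  + by lia.
- by lia.
Qed.

Import Order.TTheory GRing.Theory Num.Theory.
Local Open Scope ring_scope.

Theorem theorem3p1 :
  exists time_poly size_poly : {poly rat},
  forall alpha : rat, 0 < alpha < 1 ->
  exists (algo : cmd) (K : nat),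
  forall (n : nat) (F : cnf n), is_kcnf 2 F ->
  forall w : nat, (K * (n + size F).+1 <= 2 ^ w)%N ->
  exists (t : nat) (mu : memory),
    [/\ exec w algo (input_memory F) t mu,
        t%:R <= (size F).+1%:R * time_poly.[alpha^-1],
        outputs_answer mu (alpha * 2 ^+ n <= (nsat F)%:R)
      & alpha * 2 ^+ n <= (nsat F)%:R ->
        outputs_count n mu (nsat F) /\
        exists T : dtree n,
          [/\ represents T F,
              (dtree_size T)%:R <= size_poly.[alpha^-1]
            & outputs_dtree mu T]].
Proof.
(* The factor 4 and the degree come from [4 ^ L <= 4 * alpha^-1 ^+ 5]; 1000 and 2 are the factors of
   [4 ^ L] in the bounds on time and size. *)
exists ((1000%:R * 4%:R) *: 'X^5), ((2%:R * 4%:R) *: 'X^5) => alpha /andP[al0 al1].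
have [a [b [/andP[a0 ab] alE]]] : exists a b : nat, (0 < a < b)%N /\ alpha = a%:R / b%:R.
  exists `|numq alpha|%N, `|denq alpha|%N.
  have nE : (`|numq alpha|%N : int) = numq alpha.
    by rewrite gez0_abs // numq_ge0 ltW.
  have dE : (`|denq alpha|%N : int) = denq alpha by rewrite gez0_abs // denq_ge0.
  have E : alpha = (`|numq alpha|%N)%:R / (`|denq alpha|%N)%:R.
    by rewrite -[LHS]divq_num_den -nE -dE.
  split=> //; apply/andP; split; first by rewrite absz_gt0 numq_eq0 gt_eqF.
  move: al1; rewrite {1}E ltr_pdivrMr ?mul1r ?ltr_nat //.
  by rewrite ltr0n absz_gt0 denq_eq0.
have b0 : 0 < b%:R :> rat by rewrite ltr0n; apply: leq_ltn_trans ab.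
have cmpE n v : (alpha * 2 ^+ n <= v%:R) = (a * 2 ^ n <= b * v)%N.
  by rewrite alE mulrAC ler_pdivrMr // -natrX -!natrM ler_nat [(v * b)%N]mulnC.
have [L [abL small]] : exists L, (b * 3 ^ L < a * 4 ^ L /\ a ^ 5 * 4 ^ L <= 4 * b ^ 5)%N.
  by apply: exists_threshold; rewrite a0.
have pow_le : (4 ^ L)%:R <= 4%:R * alpha^-1 ^+ 5 :> rat.
  rewrite alE invf_div expr_div_n mulrA ler_pdivlMr ?exprn_gt0 ?ltr0n //.
  by rewrite -!natrX -!natrM ler_nat mulnC.
exists (count_models a b L), (64 + 8 * 4 ^ L + 4 * b)%N => n F kF w Hw.
have a0b : (0 < a < b)%N by rewrite a0.
have [t [mu [E le_t [ans out]]]] := count_models_correct a0b abL kF Hw.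
exists t, mu; rewrite cmpE; split=> //.
  apply: le_trans (_ : (4 ^ L * (1000 * (size F).+1))%:R <= _); first by rewrite ler_nat.
  rewrite hornerZ hornerXn; move: 1000%N => c.
  rewrite !natrM mulrC [c%:R * _]mulrC -!mulrA.
  by rewrite !ler_wpM2l ?ler0n.
move=> /out [oc [T [rT szT oT]]]; split=> //; exists T; split=> //.
rewrite hornerZ hornerXn -mulrA.
apply: (@le_trans _ _ (2 * 4 ^ L)%:R); first by rewrite ler_nat ltnW.
by rewrite natrM ler_pM2l ?ltr0n.
Qed.
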